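(* If $X$ is a $\Delta\circlearrowright\Gamma$-space, then so is its classifying space $BX$.
   Context: Notation. $\mathcal{SS}ets$ is the category of simplicial sets; $\Delta$ is the category of finite ordered sets $[n]=\{0<1<\dots<n\}$ and order-preserving maps; $\mathcal Fin$ is (a skeleton of) the category of finite sets; $\mathcal P\colon\mathcal Fin\to\mathcal Fin$ is the covariant power set functor (direct image); $\underline n=\{1,\dots,n\}$. $\Gamma$ is Segal's category: objects finite sets (one per isomorphism class), morphisms $S\to T$ the maps $\theta\colon S\to\mathcal P(T)$ with $\theta(\alpha)\cap\theta(\beta)=\varnothing$ for $\alpha\ne\beta$, composition $(\psi\theta)(\alpha)=\bigcup_{\beta\in\theta(\alpha)}\psi(\beta)$. $\Gamma^{op}$ is identified with the category of pointed sets $\mathbf n=\{0,1,\dots,n\}$ and basepoint-preserving maps, $\mathbf n$ corresponding to $\underline n$. Segal's functor $\Delta\to\Gamma$ sends $[n]$ to $\underline n$ and $f\colon[m]\to[n]$ to $\theta(i)=\{j\in\underline n\mid f(i-1)<j\le f(i)\}$. The category $\mathcal L$. Objects are functors $F\colon\mathcal C\to\mathcal Fin$, with $\mathcal C$ a category with finitely many objects. A morphism from $F\colon\mathcal C\to\mathcal Fin$ to $G\colon\mathcal D\to\mathcal Fin$ is a pair $(f,\eta)$ of a functor $f\colon\mathcal C\to\mathcal D$ and a natural transformation $\eta\colon F\Rightarrow\mathcal PGf$ such that whenever $f(c)=f(c')=d$, $x\in F(c)$, $y\in F(c')$, the subsets $\eta_c(x),\eta_{c'}(y)$ of $G(d)$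 are disjoint unless $c=c'$ and $x=y$. Composition uses the monad structure of $\mathcal P$ (unions): the composite of $(f,\eta)$ with $(g,\zeta)$ is $gf$ with $x\in F(c)\mapsto\bigcup_{y\in\eta_c(x)}\zeta_{f(c)}(y)$. The category $\Delta\circlearrowright\Gamma$ is the full subcategory of $\mathcal L$ on the objects $C_{m,n}$, $m,n\ge0$, where $C_{m,n}\colon[m]\to\mathcal Fin$ is the constant functor with value $\underline n$. There are full embeddings $C_{0,-}\colon\Gamma\to\Delta\circlearrowright\Gamma$, $\underline n\mapsto C_{0,n}$, and $C_{-,0}\colon\Delta\to\Delta\circlearrowright\Gamma$, $[m]\mapsto C_{m,0}$. For $X\colon(\Delta\circlearrowright\Gamma)^{op}\to\mathcal{SS}ets$ put $X^\Gamma=X\circ C_{0,-}\colon\Gamma^{op}\to\mathcal{SS}ets$ and $X^\Delta=X\circ C_{-,0}\colon\Delta^{op}\to\mathcal{SS}ets$; so $X^\Gamma(\mathbf n)=X(C_{0,n})$ and $X^\Delta_m=X(C_{m,0})$. Maps. $\ell_1\colon C_{m,0}\to C_{m,n}$ is the unique morphism $(f,\eta)$ with $f=\mathrm{id}_{[m]}$. $\ell_2\colon C_{0,n}\to C_{m,n}$ is the morphism $(f,\eta)$ with $f(0)=m$ and $\eta_0(i)=\{i\}$ for $i\in\underline n$. They induce $\ell_1\times\ell_2\colon X(C_{m,n})\to X(C_{m,0})\times_{X(C_{0,0})}X(C_{0,n})=X^\Delta_m\times_{X^\Delta_0}X^\Gamma(\mathbf n)$. The Segal map $X^\Gamma(\mathbf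 n)\to X^\Gamma(\mathbf 1)^n$ is induced by the pointed maps $\varphi_{n,k}\colon\mathbf n\to\mathbf 1$, $1\le k\le n$, with $\varphi_{n,k}(i)=1$ if $i=k$ and $0$ otherwise. The Bousfield-Segal map $X^\Delta_n\to(X^\Delta_1)^n$ is induced by the maps $\gamma^{n,k}\colon[1]\to[n]$, $0\mapsto0$, $1\mapsto k+1$, $0\le k<n$. A $\Delta\circlearrowright\Gamma$-space is a functor $X\colon(\Delta\circlearrowright\Gamma)^{op}\to\mathcal{SS}ets$ such that: (1) $X(C_{0,0})=X^\Delta_0=X^\Gamma(\mathbf 0)$ is a single point; (2) the Segal maps $X^\Gamma(\mathbf n)\to X^\Gamma(\mathbf 1)^n$ are weak equivalences for all $n$; (3) the Bousfield-Segal maps $X^\Delta_n\to(X^\Delta_1)^n$ are weak equivalences for all $n$; (4) the maps $\ell_1\times\ell_2\colon X(C_{m,n})\to X^\Delta_m\times X^\Gamma(\mathbf n)$ are weak equivalences for all $m,n$. Classifying space. There is a bifunctor $\mu\colon\Gamma\times(\Delta\circlearrowright\Gamma)\to\Delta\circlearrowright\Gamma$, $\mu(\underline p,C_{m,n})=C_{m,np}$, obtained from $(S,F)\mapsto(i\mapsto S\times F(i))$: a morphism $(f,\eta)\colon F\to G$ is sent to $(f,S\times\eta)$ with $(S\times\eta)_i(s,x)=\{s\}\times\eta_i(x)$, and $\theta\colon S\to T$ in $\Gamma$ is sent to $(\mathrm{id},\theta\times F)$ with $(\theta\times F)_i(s,x)=\theta(s)\times\{x\}$. Given $X\colon (\Delta\circlearrowright\Gamma)^{op}\to\mathcal{SS}ets$,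 the composite $\Delta^{op}\times(\Delta\circlearrowright\Gamma)^{op}\to\Gamma^{op}\times(\Delta\circlearrowright\Gamma)^{op}\xrightarrow{\mu}(\Delta\circlearrowright\Gamma)^{op}\xrightarrow{X}\mathcal{SS}ets$, whose first map uses Segal's functor, has adjoint $bX\colon(\Delta\circlearrowright\Gamma)^{op}\to\mathcal{SS}ets^{\Delta^{op}}$, and $BX\colon(\Delta\circlearrowright\Gamma)^{op}\to\mathcal{SS}ets$ is $bX$ followed by the usual geometric realization $|-|\colon\mathcal{SS}ets^{\Delta^{op}}\to\mathcal{SS}ets$ of simplicial spaces (coend with the simplices $\Delta[p]$, equivalently the diagonal). *)

(* Defs.v *)
From Stdlib Require Import Relations.
From Stdlib Require List.
From mathcomp Require Import all_boot matrix.
From mathcomp Require Import boolp.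

Set Implicit Arguments.
Unset Strict Implicit.
Unset Printing Implicit Defensive.

(* [mcomp g f] is "g after f". *)

Record cat := Cat {
  ob :> Type;
  hom : ob -> ob -> Type;
  idm : forall a, hom a a;
  mcomp : forall a b d, hom b d -> hom a b -> hom a d;
  comp1m : forall a b (f : hom a b), mcomp (idm b) f = f;
  compm1 : forall a b (f : hom a b), mcomp f (idm a) = f;
  compA : forall a b c d (h : hom c d) (g : hom b c) (f : hom a b),
    mcomp h (mcomp g f) = mcomp (mcomp h g) f }.

Arguments hom {C} _ _ : rename.
Arguments idm {C} a : rename.
Arguments mcomp {C a b d} _ _ : rename.

Record functor (C D : cat) := Functor {
  fob :> C -> D;
  fmap : forall a b, hom a b -> hom (fob a) (fob b);
  fmap1 : forall a, fmap (idm a) = idm (fob a);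
  fmapM : forall a b c (g : hom b c) (f : hom a b),
    fmap (mcomp g f) = mcomp (fmap g) (fmap f) }.

Arguments fmap {C D} f {a b} _ : rename.

Record natT (C D : cat) (F G : functor C D) := NatT {
  app :> forall a, hom (F a) (G a);
  natural : forall a b (f : hom a b),
    mcomp (app b) (fmap F f) = mcomp (fmap G f) (app a) }.

Lemma natT_ext (C D : cat) (F G : functor C D) (s t : natT F G) :
  (forall a, s a = t a) -> s = t.
Proof.
case: s t => [s ns] [t nt] /= st.
have {}st : s = t by exact: functional_extensionality_dep.
by subst t; congr NatT; exact: Prop_irrelevance.
Qed.

Lemma functor_irr (C D : cat) o h p1 p2 q1 q2 :
  @Functor C D o h p1 p2 = @Functor C D o h q1 q2.
Proof. by congr Functor; exact: Prop_irrelevance. Qed.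

Definition idF (C : cat) : functor C C :=
  @Functor C C (fun a => a) (fun a b f => f)
    (fun a => erefl) (fun a b c g f => erefl).

Definition compF (C D E : cat) (G : functor D E) (F : functor C D) :
  functor C E.
Proof.
refine (@Functor C E (fun a => G (F a)) (fun a b f => fmap G (fmap F f)) _ _).
- by move=> a; rewrite !fmap1.
- by move=> a b c g f; rewrite !fmapM.
Defined.

Definition constF (C D : cat) (d : D) : functor C D.
Proof.
refine (@Functor C D (fun _ => d) (fun _ _ _ => idm d) _ _) => //.
by move=> a b c g f; rewrite comp1m.
Defined.

Definition opC (C : cat) : cat.
Proof.
refine (@Cat C (fun a b => hom b a) idm (fun a b c g f => mcomp f g) _ _ _).
- by move=> a b f; rewrite compm1.
- by move=> a b f; rewrite comp1m.
- by move=> a b c d h g f; rewrite compA.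
Defined.

Definition opF (C D : cat) (F : functor C D) : functor (opC C) (opC D) :=
  @Functor (opC C) (opC D) F (fun a b f => @fmap _ _ F b a f)
    (fun a => fmap1 F a) (fun a b c g f => fmapM F f g).

Definition prodC (C D : cat) : cat.
Proof.
refine (@Cat (C * D)%type (fun a b => hom a.1 b.1 * hom a.2 b.2)%type
  (fun a => (idm a.1, idm a.2))
  (fun a b c g f => (mcomp g.1 f.1, mcomp g.2 f.2)) _ _ _).
- by move=> a b [f1 f2] /=; rewrite !comp1m.
- by move=> a b [f1 f2] /=; rewrite !compm1.
- by move=> a b c d h g f /=; rewrite !compA.
Defined.

Definition prodF (C D C' D' : cat) (F : functor C C') (G : functor D D') :
  functor (prodC C D) (prodC C' D').
Proof.
refine (@Functor (prodC C D) (prodC C' D') (fun a => (F a.1, G a.2))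
  (fun a b f => (fmap F f.1, fmap G f.2)) _ _).
- by move=> a /=; rewrite !fmap1.
- by move=> a b c g f /=; rewrite !fmapM.
Defined.

Definition idT (C D : cat) (F : functor C D) : natT F F.
Proof.
refine (@NatT C D F F (fun a => idm (F a)) _).
by move=> a b f; rewrite comp1m compm1.
Defined.

Definition compT (C D : cat) (F G H : functor C D)
  (t : natT G H) (s : natT F G) : natT F H.
Proof.
refine (@NatT C D F H (fun a => mcomp (t a) (s a)) _).
by move=> a b f; rewrite -compA natural compA natural compA.
Defined.

Definition functorC (C D : cat) : cat.
Proof.
refine (@Cat (functor C D) (@natT C D) (@idT C D) (@compT C D) _ _ _).
- by move=> F G s; apply: natT_ext => a /=; rewrite comp1m.
- by move=> F G s; apply: natT_ext => a /=; rewrite compm1.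
- by move=> F G H K u t s; apply: natT_ext => a /=; rewrite compA.
Defined.

Definition curry_ob (C D E : cat) (F : functor (opC (prodC C D)) E) (d : D) :
  functor (opC C) E.
Proof.
refine (@Functor (opC C) E (fun c => F (c, d))
  (fun a b f => @fmap _ _ F (a, d) (b, d) (f, idm d)) _ _).
- by move=> c; rewrite -(fmap1 F).
- by move=> a b c g f; rewrite -fmapM /= comp1m.
Defined.

Definition curry_hom (C D E : cat) (F : functor (opC (prodC C D)) E) (d e : D)
  (f : hom e d) : natT (curry_ob F d) (curry_ob F e).
Proof.
refine (@NatT _ _ (curry_ob F d) (curry_ob F e)
  (fun c => @fmap _ _ F (c, d) (c, e) (idm c, f)) _).
by move=> a b g /=; rewrite -!fmapM /= !comp1m !compm1.
Defined.

(* The adjoint of a functor C^op x D^op -> E, valued in simplicial objects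
   when C = Delta. *)
Definition curry_op (C D E : cat) (F : functor (opC (prodC C D)) E) :
  functor (opC D) (functorC (opC C) E).
Proof.
refine (@Functor (opC D) (functorC (opC C) E) (curry_ob F)
  (@curry_hom C D E F) _ _).
- by move=> d; apply: natT_ext => c; rewrite /= -(fmap1 F).
- by move=> d e e' g f; apply: natT_ext => c; rewrite /= -fmapM /= comp1m.
Defined.

Definition TypeC : cat :=
  @Cat Type (fun S T => S -> T) (fun S x => x) (fun S T U g f x => g (f x))
    (fun _ _ _ => erefl) (fun _ _ _ => erefl) (fun _ _ _ _ _ _ _ => erefl).

Definition FinC : cat :=
  @Cat finType (fun S T => S -> T) (fun S x => x) (fun S T U g f x => g (f x))
    (fun _ _ _ => erefl) (fun _ _ _ => erefl) (fun _ _ _ _ _ _ _ => erefl).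

Definition PowF : functor FinC FinC.
Proof.
refine (@Functor FinC FinC (fun S => {set S})
  (fun (S T : finType) (f : S -> T) (A : {set S}) => f @: A) _ _).
- by move=> S; apply: funext => A; rewrite /= imset_id.
- by move=> S T U g f; apply: funext => A; rewrite /= imset_comp.
Defined.

(* The object m of Delta is [m] = {0,...,m}, represented by 'I_m.+1. *)

Record dhom (m n : nat) := DHom {
  dfun :> 'I_m.+1 -> 'I_n.+1;
  dmono : forall i j : 'I_m.+1, i <= j -> dfun i <= dfun j }.

Lemma dhom_ext m n (f g : dhom m n) : (forall i, f i = g i) -> f = g.
Proof.
case: f g => [f pf] [g pg] /= /funext fg; subst g.
by congr DHom; exact: Prop_irrelevance.
Qed.

Definition did m : dhom m m := @DHom m m (fun i => i) (fun i j ij => ij).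

Definition dcomp m n p (g : dhom n p) (f : dhom m n) : dhom m p :=
  @DHom m p (fun i => g (f i)) (fun i j ij => dmono g (dmono f ij)).

Definition Delta : cat.
Proof. by refine (@Cat nat dhom did dcomp _ _ _) => *; apply: dhom_ext. Defined.

Definition dconst m n (i : 'I_n.+1) : @hom Delta m n :=
  @DHom m n (fun _ => i) (fun _ _ _ => leqnn i).

(* gamma^{n,k} : [1] -> [n], 0 |-> 0 and 1 |-> k + 1. *)
Definition dgamma n (k : 'I_n) : @hom Delta 1 n.
Proof.
refine (@DHom 1 n (fun i => if i == ord0 then ord0 else lift ord0 k) _).
by move=> i j ij; case: eqP => // i0; case: eqP => // j0; case: i0; apply/val_inj;
   move: ij; rewrite j0 leqn0 => /eqP.
Defined.

(* The object n of Gamma is {1,...,n}, represented by 'I_n. *)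

Record ghom (m n : nat) := GHom {
  gfun :> 'I_m -> {set 'I_n};
  gdisj : forall a b, a != b -> [disjoint gfun a & gfun b] }.

Lemma ghom_ext m n (f g : ghom m n) : (forall i, f i = g i) -> f = g.
Proof.
case: f g => [f pf] [g pg] /= /funext fg; subst g.
by congr GHom; exact: Prop_irrelevance.
Qed.

Lemma ghomP m n (f : ghom m n) a b z : z \in f a -> z \in f b -> a = b.
Proof.
move=> za zb; apply/eqP/negPn/negP => /(gdisj f).
by rewrite disjoint_subset => /subsetP/(_ z za); rewrite inE zb.
Qed.

Lemma ghomI m n (f : 'I_m -> {set 'I_n}) :
  (forall a b z, z \in f a -> z \in f b -> a = b) ->
  forall a b, a != b -> [disjoint f a & f b].
Proof.
move=> H a b; apply: contraNT => /pred0Pn[z /andP[/= za zb]].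
by apply/eqP; exact: H za zb.
Qed.

Definition gid n : ghom n n.
Proof.
refine (@GHom n n (fun i => [set i]) _).
by apply: ghomI => a b z /set1P-> /set1P.
Defined.

Definition gcomp m n p (g : ghom n p) (f : ghom m n) : ghom m p.
Proof.
refine (@GHom m p (fun a => \bigcup_(b in f a) g b) _).
apply: ghomI => a b z /bigcupP[x xa zx] /bigcupP[y yb zy].
by rewrite -(ghomP zx zy) in yb; exact: ghomP xa yb.
Defined.

Definition Gamma : cat.
Proof.
refine (@Cat nat ghom gid gcomp _ _ _).
- move=> m n f; apply: ghom_ext => a /=; apply/setP => z.
  apply/bigcupP/idP => [[x xa /set1P->]//|za]; exists z => //.
  exact/set1P.
- by move=> m n f; apply: ghom_ext => a /=; rewrite big_set1.
- move=> m n p q h g f; apply: ghom_ext => a /=; apply/setP => z.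
  apply/bigcupP/bigcupP.
  + move=> [x /bigcupP[y ya xy] zx]; exists y => //.
    by apply/bigcupP; exists x.
  + move=> [y ya /bigcupP[x xy zx]]; exists x => //.
    by apply/bigcupP; exists y.
Defined.

(* Under Gamma^op = pointed finite sets, a pointed map f : n -> m is the
   morphism i |-> f^-1(i) of Gamma from m to n; for phi_{n,k} : n -> 1 it sends
   the only element of {1} to {k}. *)
Definition gphi n (k : 'I_n) : @hom Gamma 1 n.
Proof.
refine (@GHom 1 n (fun _ => [set k]) _).
by move=> a b; rewrite !ord1 eqxx.
Defined.

(* Segal's functor.  The element i of 'I_m stands for i + 1, so the condition
   f(i-1) < j <= f(i) of the 1-based convention reads f(i) <= j < f(i+1). *)
Definition segal_fun m n (f : dhom m n) (i : 'I_m) : {set 'I_n} :=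
  [set j : 'I_n | f (widen_ord (leqnSn m) i) <= j < f (lift ord0 i)].

Lemma segal_disj m n (f : dhom m n) (a b : 'I_m) (z : 'I_n) :
  z \in segal_fun f a -> z \in segal_fun f b -> a = b.
Proof.
have H (x y : 'I_m) : x < y -> z \in segal_fun f x -> z \in segal_fun f y -> False.
  move=> xy; rewrite !inE => /andP[_ zx] /andP[zy _].
  have : f (lift ord0 x) <= f (widen_ord (leqnSn m) y) by apply: dmono.
  by move=> /leq_trans/(_ zy); rewrite leqNgt zx.
move=> za zb; apply/val_inj; case: (ltngtP a b) => // ab.
- by case: (H _ _ ab za zb).
- by case: (H _ _ ab zb za).
Qed.

Definition segal_hom m n (f : @hom Delta m n) : @hom Gamma m n :=
  @GHom m n (segal_fun f) (ghomI (@segal_disj m n f)).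

Definition segal : functor Delta Gamma.
Proof.
refine (@Functor Delta Gamma (fun n => n) segal_hom _ _).
- move=> m; apply: ghom_ext => i; apply/setP => j.
  by rewrite !inE /= /bump /= add1n ltnS -eqn_leq eq_sym.
- move=> m n p g f; apply: ghom_ext => i /=; apply/setP => z; rewrite inE /=.
  apply/idP/bigcupP.
  + move=> /andP[lo hi].
    have : exists k : nat, [exists y : 'I_p.+1, [exists x : 'I_n.+1,
       [&& (x == k :> nat), (y == g x) & (z < y)]]].
      exists (f (lift ord0 i)); apply/existsP; exists (g (f (lift ord0 i))).
      by apply/existsP; exists (f (lift ord0 i)); rewrite !eqxx.
    move=> /ex_minnP[k /existsP[y /existsP[x /and3P[/eqP xk /eqP -> zx]]] kmin].
    have kf : k <= f (lift ord0 i).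
      apply: kmin; apply/existsP; exists (g (f (lift ord0 i))).
      by apply/existsP; exists (f (lift ord0 i)); rewrite !eqxx.
    have fk : f (widen_ord (leqnSn m) i) < k.
      rewrite ltnNge -xk; apply/negP => /(dmono g) /leq_trans/(_ lo).
      by rewrite leqNgt zx.
    have k0 : 0 < k by case: k fk {kmin kf xk}.
    have kn : k.-1 < n by rewrite prednK // -ltnS -xk.
    exists (Ordinal kn).
      by rewrite inE /= -ltnS prednK // fk.
    rewrite inE; apply/andP; split; last first.
      suff -> : lift ord0 (Ordinal kn) = x by [].
      by apply/val_inj; rewrite /= /bump /= add1n prednK.
    rewrite leqNgt; apply/negP => zk.
    have /kmin : [exists y : 'I_p.+1, [exists x : 'I_n.+1,
       [&& (x == k.-1 :> nat), (y == g x) & (z < y)]]].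
      apply/existsP; exists (g (widen_ord (leqnSn n) (Ordinal kn))).
      by apply/existsP; exists (widen_ord (leqnSn n) (Ordinal kn)); rewrite !eqxx.
    by rewrite -{1}(prednK k0) ltnn.
  + move=> [y]; rewrite !inE => /andP[fy yf] /andP[gz zg]; apply/andP; split.
      exact: leq_trans (dmono g _) gz.
    exact: leq_trans zg (dmono g _).
Defined.

Definition finite_objects (C : cat) : Prop :=
  exists s : seq C, forall c, List.In c s.

(* Lob, Lhom, Lid, Lcomp make up the category L of diagrams F : C -> FinC; it is
   not packaged as a [cat], whose universe is below that of [Lob]. *)
Record Lob := LOb {
  Lcat : cat;
  Lfin : finite_objects Lcat;
  Ldiag :> functor Lcat FinC }.

(* A pair (c, x) with x in F(c) is an element of the total space of F.  The
   disjointness condition says that two pairs (c, x), (c', y) with f c = f c'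
   whose images eta_c x, eta_c' y share an element of G(f c) = G(f c') are
   equal; stating it in the total spaces avoids transport along f c = f c'. *)
Definition tot (F : Lob) (c : Lcat F) (x : F c) : {c : Lcat F & F c} :=
  existT (fun c : Lcat F => F c) c x.

Record Lhom (F G : Lob) := LHom {
  Lf : functor (Lcat F) (Lcat G);
  Leta : natT F (compF PowF (compF G Lf));
  Ldisj : forall c c' (x : F c) (y : F c') (z : G (Lf c)) (z' : G (Lf c')),
    z \in (Leta c x : {set G (Lf c)}) -> z' \in (Leta c' y : {set G (Lf c')}) ->
    tot z = tot z' -> tot x = tot y }.


Lemma existT_inj (T : Type) (P : T -> Type) a (x y : P a) :
  existT P a x = existT P a y -> x = y.
Proof.
by move=> e; have := projT2_eq e; rewrite (Prop_irrelevance (projT1_eq e) erefl).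
Qed.

Lemma Lhom_ext (F G : Lob) (u v : Lhom F G) : Lf u = Lf v ->
  (forall c (x : F c),
    existT (fun d : Lcat G => {set (G d : finType)}) (Lf u c) (Leta u c x) =
    existT (fun d : Lcat G => {set (G d : finType)}) (Lf v c) (Leta v c x)) ->
  u = v.
Proof.
case: u v => [f s p] [g t q] /= e; subst g => st.
have {}st : s = t.
  by apply: natT_ext => c; apply: functional_extensionality_dep => x;
    exact: existT_inj (st c x).
by subst t; congr LHom; exact: Prop_irrelevance.
Qed.

Definition Lid_eta (F : Lob) : natT F (compF PowF (compF F (idF _))).
Proof.
refine (@NatT _ _ F (compF PowF (compF F (idF _)))
  (fun c (x : F c) => [set x]) _).
by move=> c d u; apply: funext => x /=; rewrite imset_set1.
Defined.

Definition Lid (F : Lob) : Lhom F F.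
Proof.
refine (@LHom F F (idF _) (Lid_eta F) _).
by move=> c c' x y z z' /set1P-> /set1P->.
Defined.

Definition Lcomp_eta (F G H : Lob) (v : Lhom G H) (u : Lhom F G) :
  natT F (compF PowF (compF H (compF (Lf v) (Lf u)))).
Proof.
refine (@NatT _ _ F (compF PowF (compF H (compF (Lf v) (Lf u))))
  (fun c (x : F c) => \bigcup_(y in (Leta u c x : {set (G _ : finType)}))
     (Leta v (Lf u c) y : {set (H _ : finType)})) _).
move=> c d f; apply: funext => x /=.
have -> : Leta u d (fmap F f x) =
      (fmap G (fmap (Lf u) f)) @: (Leta u c x : {set (G _ : finType)}).
    exact: (congr1 (fun h => h x) (natural (Leta u) f)).
have E y : Leta v (Lf u d) (fmap G (fmap (Lf u) f) y) =
      (fmap H (fmap (Lf v) (fmap (Lf u) f))) @: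
        (Leta v (Lf u c) y : {set (H _ : finType)}).
    exact: (congr1 (fun h => h y) (natural (Leta v) (fmap (Lf u) f))).
apply/setP => z; apply/bigcupP/imsetP.
- move=> [_ /imsetP[y yx ->]]; rewrite E => /imsetP[w wy ->].
    by exists w => //; apply/bigcupP; exists y.
- move=> [w /bigcupP[y yx wy] ->]; exists (fmap G (fmap (Lf u) f) y).
      exact: imset_f.
    by rewrite E; exact: imset_f.
Defined.

Definition Lcomp (F G H : Lob) (v : Lhom G H) (u : Lhom F G) : Lhom F H.
Proof.
refine (@LHom F H (compF (Lf v) (Lf u)) (Lcomp_eta v u) _).
move=> c c' x y z z' /bigcupP[w wx zw] /bigcupP[w' wy zw'] zz.
by apply: (Ldisj wx wy); exact: Ldisj zw zw' zz.
Defined.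

Lemma Lcomp1m F G (u : Lhom F G) : Lcomp (Lid G) u = u.
Proof.
case: u => [[o h p q] s d]; apply: Lhom_ext; first exact: functor_irr.
move=> c x /=; congr existT; apply/setP => z.
apply/bigcupP/idP => [[y ys /set1P->]//|zs]; exists z => //; exact/set1P.
Qed.

Lemma Lcompm1 F G (u : Lhom F G) : Lcomp u (Lid F) = u.
Proof.
case: u => [[o h p q] s d]; apply: Lhom_ext; first exact: functor_irr.
by move=> c x /=; congr existT; rewrite big_set1.
Qed.

Lemma LcompA F G H K (w : Lhom H K) (v : Lhom G H) (u : Lhom F G) :
  Lcomp w (Lcomp v u) = Lcomp (Lcomp w v) u.
Proof.
apply: Lhom_ext; first exact: functor_irr.
move=> c x /=; congr existT; apply/setP => z; apply/bigcupP/bigcupP.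
- move=> [y /bigcupP[t tx yt] zy]; exists t => //.
  by apply/bigcupP; exists y.
- move=> [t tx /bigcupP[y yt zy]]; exists y => //.
  by apply/bigcupP; exists t.
Qed.

Definition ordC (m : nat) : cat :=
  @Cat 'I_m.+1 (fun i j => i <= j) (fun i => leqnn i)
    (fun i j k jk ij => leq_trans ij jk)
    (fun _ _ _ => Prop_irrelevance _ _) (fun _ _ _ => Prop_irrelevance _ _)
    (fun _ _ _ _ _ _ _ => Prop_irrelevance _ _).

Lemma ordC_irr m (i j : ordC m) (u v : hom i j) : u = v.
Proof. exact: (@Prop_irrelevance (is_true ((i : 'I_m.+1) <= (j : 'I_m.+1)))). Qed.

Lemma ordC_finite m : finite_objects (ordC m).
Proof.
exists (enum 'I_m.+1) => c.
have := mem_enum 'I_m.+1 c; rewrite inE; elim: (enum _) => //= a s IH.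
by rewrite inE => /orP[/eqP->|/IH]; [left|right].
Qed.

Definition Cst (m n : nat) : Lob :=
  LOb (ordC_finite m) (@constF (ordC m) FinC 'I_n).

(* The full subcategory of L on the objects C_{m,n}; the pair (m, n) is
   C_{m,n}. *)
Definition DG : cat :=
  @Cat (nat * nat)%type (fun a b => Lhom (Cst a.1 a.2) (Cst b.1 b.2))
    (fun a => Lid _) (fun a b c => @Lcomp _ _ _)
    (fun a b => @Lcomp1m _ _) (fun a b => @Lcompm1 _ _)
    (fun a b c d => @LcompA _ _ _ _).

Lemma ordF_ext (C : cat) n (f g : functor C (ordC n)) :
  (forall c, f c = g c) -> f = g.
Proof.
case: f g => [f fm f1 fM] [g gm g1 gM] /= /funext fg; subst g.
have e : fm = gm.
  apply: functional_extensionality_dep => a.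
  apply: functional_extensionality_dep => b.
  by apply: functional_extensionality_dep => u; exact: ordC_irr.
by subst gm; exact: functor_irr.
Qed.

Lemma DG_ext m n p q (u v : @hom DG (m, n) (p, q)) :
  (forall i, Lf u i = Lf v i) ->
  (forall i (x : 'I_n), Leta u i x = Leta v i x :> {set 'I_q}) -> u = v.
Proof.
move=> uv1 uv2; apply: Lhom_ext; first exact: ordF_ext.
by move=> i x /=; rewrite uv1 uv2.
Qed.

Definition ordF m n (f : dhom m n) : functor (ordC m) (ordC n) :=
  @Functor (ordC m) (ordC n) f (@dmono _ _ f)
    (fun _ => ordC_irr _ _) (fun _ _ _ _ _ => ordC_irr _ _).

Definition DGhom_eta m n p q (f : dhom m p) (theta : 'I_n -> {set 'I_q}) :
  natT (Cst m n) (compF PowF (compF (Cst p q) (ordF f))).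
Proof.
refine (@NatT _ _ (Cst m n) (compF PowF (compF (Cst p q) (ordF f)))
  (fun _ => theta) _).
by move=> i j u; apply: funext => x /=; rewrite imset_id.
Defined.

(* A morphism C_{m,n} -> C_{p,q} with f : [m] -> [p] and eta_i = theta for all
   i in [m] (naturality forces eta_i to be independent of i). *)
Definition DGhom m n p q (f : dhom m p) (theta : 'I_n -> {set 'I_q})
  (H : forall i j x y z, f i = f j -> z \in theta x -> z \in theta y ->
       i = j /\ x = y) : @hom DG (m, n) (p, q).
Proof.
refine (@LHom (Cst m n) (Cst p q) (ordF f) (DGhom_eta f theta) _).
move=> i j x y z z' zx zy zz /=.
have /= fij : f i = f j := congr1 (@projT1 _ _) zz.
have zz' : z = z' :=
  congr1 (fun t : {_ : 'I_p.+1 & 'I_q} => projT2 t) zz.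
rewrite -zz' in zy.
by have [-> ->] := H _ _ _ _ _ fij zx zy.
Defined.

Lemma DG_disj m n p q (u : @hom DG (m, n) (p, q)) (i j : 'I_m.+1)
    (x y : 'I_n) (z : 'I_q) :
  Lf u i = Lf u j -> z \in (Leta u i x : {set 'I_q}) ->
  z \in (Leta u j y : {set 'I_q}) -> i = j /\ x = y.
Proof.
move=> uij zx zy.
have E : @tot (Cst m n) i x = @tot (Cst m n) j y.
  apply: (@Ldisj (Cst m n) (Cst p q) u i j x y z z zx zy).
  exact: (congr1 (fun k => existT (fun _ : 'I_p.+1 => 'I_q) k z) uij).
split; first exact: (congr1 (@projT1 _ _) E).
exact: (congr1 (fun t : {_ : 'I_m.+1 & 'I_n} => projT2 t) E).
Qed.

Definition CG_hom m n (theta : @hom Gamma m n) : @hom DG (0, m) (0, n).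
Proof.
refine (@DGhom 0 m 0 n (did 0) theta _).
by move=> i j x y z _ zx zy; rewrite (ghomP zx zy) !ord1.
Defined.

Definition CG : functor Gamma DG.
Proof.
refine (@Functor Gamma DG (fun n => (0, n)) CG_hom _ _).
- by move=> m; apply: DG_ext.
- by move=> m n p g f; apply: DG_ext.
Defined.

Definition CD_hom m n (f : @hom Delta m n) : @hom DG (m, 0) (n, 0).
Proof.
refine (@DGhom m 0 n 0 f (fun _ => set0) _).
by move=> i j [].
Defined.

Definition CD : functor Delta DG.
Proof.
refine (@Functor Delta DG (fun m => (m, 0)) CD_hom _ _).
- by move=> m; apply: DG_ext => // i [].
- by move=> m n p g f; apply: DG_ext => // i [].
Defined.

Definition l1 m n : @hom DG (m, 0) (m, n).
Proof.
refine (@DGhom m 0 m n (did m) (fun _ => set0) _).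
by move=> i j [].
Defined.

Definition l2 m n : @hom DG (0, n) (m, n).
Proof.
refine (@DGhom 0 n m n (@dconst 0 m ord_max) (fun i => [set i]) _).
by move=> i j x y z _ /set1P-> /set1P->; rewrite !ord1.
Defined.

(* In the bifunctor mu the product of p and n is identified with p * n by the
   lexicographic bijection 'I_p * 'I_n -> 'I_(p * n), (s, x) |-> mxvec_index s x;
   [unpair] is its inverse. *)

Definition unpair p n (k : 'I_(p * n)) : 'I_p * 'I_n :=
  enum_val (cast_ord (esym (mxvec_cast p n)) k).

Lemma mxvec_indexK p n s x : unpair (@mxvec_index p n s x) = (s, x).
Proof. by rewrite /unpair /mxvec_index cast_ordK enum_rankK. Qed.

Lemma unpairK p n (k : 'I_(p * n)) :
  mxvec_index (unpair k).1 (unpair k).2 = k.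
Proof. by case/mxvec_indexP: k => s x; rewrite mxvec_indexK. Qed.

Lemma unpair_inj p n : injective (@unpair p n).
Proof. by move=> k l kl; rewrite -(unpairK k) kl unpairK. Qed.

(* theta x A : (s, x) |-> theta(s) x A(x), for theta : S -> P(T) and
   A : F -> P(G). *)
Definition prod_img p q n r (theta : 'I_p -> {set 'I_q})
  (A : 'I_n -> {set 'I_r}) (k : 'I_(p * n)) : {set 'I_(q * r)} :=
  [set l | ((unpair l).1 \in theta (unpair k).1)
           && ((unpair l).2 \in A (unpair k).2)].

Definition mu_eta p q a b (theta : ghom p q) (u : @hom DG a b) :
  natT (Cst a.1 (p * a.2)) (compF PowF (compF (Cst b.1 (q * b.2)) (Lf u))).
Proof.
refine (@NatT _ _ (Cst a.1 (p * a.2))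
  (compF PowF (compF (Cst b.1 (q * b.2)) (Lf u)))
  (fun i => prod_img theta (Leta u i)) _).
move=> i j ij; apply: funext => k /=; rewrite imset_id.
have := natural (Leta u) ij => /= /(congr1 (fun h => h (unpair k).2)) /=.
by rewrite imset_id /prod_img => ->.
Defined.

(* mu on a pair (theta, (f, eta)): the image of theta under mu(-, F) followed by
   that of (f, eta) under mu(T, -) is (f, (s, x) |-> theta(s) x eta_i(x)). *)
Definition mu_hom p q a b (theta : ghom p q) (u : @hom DG a b) :
  @hom DG (a.1, p * a.2) (b.1, q * b.2).
Proof.
refine (@LHom (Cst a.1 (p * a.2)) (Cst b.1 (q * b.2)) (Lf u)
  (mu_eta theta u) _).
case: a b u => [m n] [m' n'] u i j x y z z' /=; rewrite !inE.
move=> /andP[z1 z2] /andP[z1' z2'] zz.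
have /= fij : Lf u i = Lf u j := congr1 (@projT1 _ _) zz.
have zz' : z = z' :=
  congr1 (fun t : {_ : 'I_m'.+1 & 'I_(q * n')} => projT2 t) zz.
rewrite -zz' in z1' z2'.
have e1 := ghomP z1 z1'; have [-> e2] := DG_disj fij z2 z2'.
congr existT; apply: unpair_inj.
by rewrite [LHS]surjective_pairing [RHS]surjective_pairing e1 e2.
Defined.

Definition mu : functor (prodC Gamma DG) DG.
Proof.
refine (@Functor (prodC Gamma DG) DG
  (fun a => (a.2.1, a.1 * a.2.2))
  (fun a b f => mu_hom f.1 f.2) _ _).
- move=> [p [m n]]; apply: DG_ext => //= i k; apply/setP => l; rewrite !inE /=.
  rewrite -(inj_eq (@unpair_inj p n)).
  by rewrite [unpair l]surjective_pairing [unpair k]surjective_pairing.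
- move=> [p [m n]] [p' [m' n']] [p'' [m'' n'']] [t v] [s u].
  apply: DG_ext => //= i k; apply/setP => l; rewrite !inE /=.
  apply/andP/bigcupP.
  + move=> [/bigcupP[x xs lx] /bigcupP[y yu ly]].
    by exists (mxvec_index x y); rewrite inE mxvec_indexK /= ?xs ?lx.
  + move=> [x]; rewrite !inE => /andP[x1 x2] /andP[l1 l2].
    by split; apply/bigcupP; [exists (unpair x).1|exists (unpair x).2].
Defined.

Definition sSet : cat := functorC (opC Delta) TypeC.

Definition is_point (X : sSet) : Prop := forall k, exists x : X k, forall y, y = x.

Definition prodS (X Y : sSet) : sSet.
Proof.
refine (@Functor (opC Delta) TypeC (fun k => X k * Y k)%type
  (fun k l f x => (fmap X f x.1, fmap Y f x.2)) _ _).
- by move=> k; apply: funext => -[x y] /=; rewrite !fmap1.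
- by move=> k l r g f; apply: funext => -[x y] /=; rewrite !fmapM.
Defined.

Definition powS (I : Type) (X : sSet) : sSet.
Proof.
refine (@Functor (opC Delta) TypeC (fun k => I -> X k)
  (fun k l f x i => fmap X f (x i)) _ _).
- by move=> k; apply: funext => x; apply: funext => i /=; rewrite fmap1.
- by move=> k l r g f; apply: funext => x; apply: funext => i /=; rewrite fmapM.
Defined.

Definition pairS (Z X Y : sSet) (f : @hom sSet Z X) (g : @hom sSet Z Y) :
  @hom sSet Z (prodS X Y).
Proof.
refine (@NatT _ _ Z (prodS X Y) (fun k z => (f k z, g k z)) _).
move=> k l u; apply: funext => z /=; congr pair.
- exact: (congr1 (fun h => h z) (natural f u)).
- exact: (congr1 (fun h => h z) (natural g u)).
Defined.

Definition tupS (I : Type) (Z X : sSet) (f : I -> @hom sSet Z X) :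
  @hom sSet Z (powS I X).
Proof.
refine (@NatT _ _ Z (powS I X) (fun k z i => f i k z) _).
move=> k l u; apply: funext => z /=; apply: funext => i.
exact: (congr1 (fun h => h z) (natural (f i) u)).
Defined.

Definition simplex (n : nat) : sSet.
Proof.
refine (@Functor (opC Delta) TypeC (fun k => dhom k n)
  (fun k l (f : dhom l k) x => dcomp x f) _ _).
- by move=> k; apply: funext => x; exact: dhom_ext.
- by move=> k l r g f; apply: funext => x; exact: dhom_ext.
Defined.

(* The horn Lambda^n_k: simplices of Delta[n] whose image misses some vertex
   other than k. *)
Definition in_horn n (k : 'I_n.+1) l (x : dhom l n) : Prop :=
  exists i, i <> k /\ forall j, x j <> i.

Lemma in_horn_comp n (k : 'I_n.+1) l r (x : dhom l n) (f : dhom r l) :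
  in_horn k x -> in_horn k (dcomp x f).
Proof. by move=> [i [ik xi]]; exists i; split=> // j; exact: xi. Qed.

Definition horn n (k : 'I_n.+1) : sSet.
Proof.
refine (@Functor (opC Delta) TypeC
  (fun l => {x : dhom l n | in_horn k x})
  (fun l r (f : dhom r l) x =>
     exist _ (dcomp (proj1_sig x) f) (in_horn_comp f (proj2_sig x))) _ _).
- by move=> l; apply: funext => -[x px]; apply: eq_exist; exact: dhom_ext.
- by move=> l r s g f; apply: funext => -[x px]; apply: eq_exist; exact: dhom_ext.
Defined.

Definition horn_incl n (k : 'I_n.+1) : @hom sSet (horn k) (simplex n) :=
  @NatT _ _ (horn k) (simplex n) (fun l x => proj1_sig x) (fun _ _ _ => erefl).

Definition Kan (K : sSet) : Prop :=
  forall n (k : 'I_n.+2) (s : @hom sSet (horn k) K),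
  exists t : @hom sSet (simplex n.+1) K, mcomp t (horn_incl k) = s.

Definition homotopy (X Y : sSet) (f g : @hom sSet X Y) : Prop :=
  exists H : @hom sSet (prodS X (simplex 1)) Y,
  forall k (x : X k), H k (x, dconst k ord0) = f k x /\
                      H k (x, dconst k ord_max) = g k x.

(* Equality in pi_0 of the function complex Y^X. *)
Definition homotopic (X Y : sSet) : @hom sSet X Y -> @hom sSet X Y -> Prop :=
  clos_refl_sym_trans _ (@homotopy X Y).

(* f is a weak (homotopy) equivalence if, for every Kan complex K, precomposition
   with f is a bijection pi_0 Fun(Y, K) -> pi_0 Fun(X, K) (the definition of
   Joyal-Tierney and of Kerodon, free of topological realization). *)
Definition weak_equiv (X Y : sSet) (f : @hom sSet X Y) : Prop :=
  forall K : sSet, Kan K ->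
  (forall h h' : @hom sSet Y K,
     homotopic (mcomp h f) (mcomp h' f) -> homotopic h h') /\
  (forall g : @hom sSet X K,
     exists h : @hom sSet Y K, homotopic (mcomp h f) g).

Definition XG (X : functor (opC DG) sSet) : functor (opC Gamma) sSet :=
  compF X (opF CG).

Definition XD (X : functor (opC DG) sSet) : functor (opC Delta) sSet :=
  compF X (opF CD).

Definition Segal_map (X : functor (opC DG) sSet) n :
  @hom sSet (XG X n) (powS 'I_n (XG X 1)) :=
  tupS (fun k : 'I_n => @fmap _ _ (XG X) n 1 (gphi k)).

Definition BSegal_map (X : functor (opC DG) sSet) n :
  @hom sSet (XD X n) (powS 'I_n (XD X 1)) :=
  tupS (fun k : 'I_n => @fmap _ _ (XD X) n 1 (dgamma k)).

Definition l1xl2 (X : functor (opC DG) sSet) m n :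
  @hom sSet (X (m, n)) (prodS (XD X m) (XG X n)) :=
  pairS (@fmap _ _ X (m, n) (m, 0) (l1 m n)) (@fmap _ _ X (m, n) (0, n) (l2 m n)).

Record DG_space (X : functor (opC DG) sSet) : Prop := {
  DG_point : is_point (X (0, 0));
  DG_Segal : forall n, weak_equiv (Segal_map X n);
  DG_BSegal : forall n, weak_equiv (BSegal_map X n);
  DG_prod : forall m n, weak_equiv (l1xl2 X m n) }.

Definition bX (X : functor (opC DG) sSet) :
  functor (opC DG) (functorC (opC Delta) sSet) :=
  curry_op (compF X (opF (compF mu (prodF segal (idF DG))))).

Definition diag (Y : functor (opC Delta) sSet) : sSet.
Proof.
refine (@Functor (opC Delta) TypeC (fun k => Y k k)
  (fun k l f y => fmap Y f l (fmap (Y k) f y)) _ _).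
- by move=> k; apply: funext => y; rewrite !fmap1.
- move=> k l r g f; apply: funext => y; rewrite !fmapM /=; congr (fmap Y g r _).
  exact: (congr1 (fun h => h (fmap (Y k) f y)) (natural (fmap Y f) g)).
Defined.

Definition diag_hom (Y Z : functor (opC Delta) sSet) (t : natT Y Z) :
  natT (diag Y) (diag Z).
Proof.
refine (@NatT _ _ (diag Y) (diag Z) (fun k => t k k) _).
move=> k l f; apply: funext => y /=.
have -> : t l l (fmap Y f l (fmap (Y k) f y)) =
          fmap Z f l (t k l (fmap (Y k) f y)).
  exact: (congr1 (fun h : natT (Y k) (Z l) => h l (fmap (Y k) f y)) (natural t f)).
congr (fmap Z f l _).
exact: (congr1 (fun h => h y) (natural (t k) f)).
Defined.

(* Geometric realization of simplicial spaces, as the diagonal. *)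
Definition realization : functor (functorC (opC Delta) sSet) sSet.
Proof.
refine (@Functor (functorC (opC Delta) sSet) sSet diag diag_hom _ _).
- by move=> Y; apply: natT_ext.
- by move=> Y Z W t s; apply: natT_ext.
Defined.

Definition BX (X : functor (opC DG) sSet) : functor (opC DG) sSet :=
  compF realization (bX X).

(* Main.v *)
(* A map of simplicial sets is a weak equivalence iff the inclusion of its source
   in the mapping cylinder is acyclic, i.e. restriction along it is a trivial
   fibration of function complexes into every Kan complex.  Acyclic inclusions
   are stable under products and pushouts and satisfy right cancellation; adding
   degenerate simplices one degeneracy at a time, a levelwise acyclic inclusion of
   simplicial spaces stays levelwise acyclic relative to the latching objects, and
   induction over the skeleta gives an acyclic inclusion of diagonals.  So a
   levelwise weak equivalence of simplicial spaces realizes to a weak equivalence.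
   The simplicial space b X is X(C_{m,np}) in degree p at C_{m,n}, and all the
   structure maps of B X are weak equivalences in each degree p: those of
   conditions (3) and (4) are structure maps of X, while the one of condition (2)
   is X(C_{0,np}) -> X(C_{0,p})^n, whose composite with a power of the Segal map
   of X at p is the Segal map of X at np. *)

From Stdlib Require Import Relations.
From mathcomp Require Import all_boot matrix boolp zify.
Require Import Defs.

Set Implicit Arguments.
Unset Strict Implicit.
Unset Printing Implicit Defensive.

(** * Partial maps and the skeletal filtration *)

(** The obstacle is that [weak_equiv] speaks only of homotopy classes, while an induction over
    skeleta needs strict extensions. Testing against the Kan complexes K^D instead of K supplies the
    strictness: surjectivity on homotopy classes becomes, by homotopy extension, strict extension
    with a parameter in D, and injectivity gives homotopies that can be corrected to be constant on
    the subobject. Hence function complexes must first be shown to be Kan, which rests on filling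
    prisms and horns with parameters. Acyclicity has a pair C in D built in, so that one notion
    serves several uses: D a simplex and C its boundary (attaching cells), D an interval and C its
    ends (homotopies), D a point and C empty (plain extension). Skeleta and latching objects are
    predicates, and maps are glued as relations; attaching a cell is then a statement about which
    simplices are new. *)

Definition act (X : sSet) k l (f : dhom l k) (x : X k) : X l :=
  @fmap (opC Delta) TypeC X k l f x.

Lemma act1 (X : sSet) k (x : X k) : act (did k) x = x.
Proof. exact: (congr1 (fun h => h x) (@fmap1 (opC Delta) TypeC X k)). Qed.

Lemma actM (X : sSet) k l m (g : dhom l k) (f : dhom m l) (x : X k) :
  act f (act g x) = act (dcomp g f) x.
Proof. by rewrite [RHS](congr1 (fun h => h x) (@fmapM (opC Delta) TypeC X k l m f g)). Qed.

Lemma hom_act (X Y : sSet) (h : @hom sSet X Y) k l (f : dhom l k) (x : X k) :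
  h l (act f x) = act f (h k x).
Proof. exact: (congr1 (fun u => u x) (@natural _ _ _ _ h k l f)). Qed.

Definition mkS (X Y : sSet) (h : forall k, X k -> Y k)
  (hn : forall k l (f : dhom l k) x, h l (act f x) = act f (h k x)) :
  @hom sSet X Y :=
  @NatT (opC Delta) TypeC X Y h
    (fun k l f => funext (fun x => hn k l f x)).

Lemma act_dconst n k l (f : dhom l k) (i : 'I_n.+1) :
  dcomp (@dconst k n i) f = @dconst l n i.
Proof. exact: dhom_ext. Qed.

Lemma dcompA m n p q (h : dhom p q) (g : dhom n p) (f : dhom m n) :
  dcomp h (dcomp g f) = dcomp (dcomp h g) f.
Proof. exact: dhom_ext. Qed.

Lemma dcompE m n p (g : dhom n p) (f : dhom m n) x : dcomp g f x = g (f x).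
Proof. by []. Qed.

Definition sub (V : sSet) := forall k, V k -> Prop.
Definition sclosed (V : sSet) (S : sub V) :=
  forall k l (f : dhom l k) x, S k x -> S l (act f x).
Definition sall (V : sSet) : sub V := fun _ _ => True.

(* A partial map from V to K is encoded by its graph, so that gluing partial
   maps is taking unions. *)
Definition srel (V K : sSet) := forall k, V k -> K k -> Prop.
Definition pmap (V K : sSet) (G : srel V K) :=
  (forall k l (f : dhom l k) x y, G k x y -> G l (act f x) (act f y)) /\
  (forall k x y y', G k x y -> G k x y' -> y = y').
Definition defined_on (V K : sSet) (G : srel V K) (S : sub V) :=
  forall k x, S k x -> exists y, G k x y.
(** [G] may be defined beyond [A], and only its values on [A] survive in [G']. Thus nothing has to
    be restricted before it is extended. *)
Definition ext (V : sSet) (A B : sub V) (K : sSet) :=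
  forall G : srel V K, pmap G -> defined_on G A ->
  exists G' : srel V K, [/\ pmap G', defined_on G' B &
    forall k x y, A k x -> G k x y -> G' k x y].

Lemma total_hom (V K : sSet) (G : srel V K) : pmap G ->
  defined_on G (@sall V) -> exists h : @hom sSet V K, forall k x, G k x (h k x).
Proof.
move=> [Gs Gf] Gd.
pose h k x := projT1 (cid (Gd k x I)).
have hP k x : G k x (h k x) by rewrite /h; case: cid.
have hn k l (f : dhom l k) x : h l (act f x) = act f (h k x).
  by apply: (Gf _ _ _ _ (hP _ _)); apply: Gs.
by exists (mkS hn).
Qed.

Lemma ext_hom (V K : sSet) (A : sub V) (G : srel V K) :
  ext A (@sall V) K -> pmap G -> defined_on G A ->
  exists h : @hom sSet V K, forall k x y, A k x -> G k x y -> h k x = y.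
Proof.
move=> E Gp Gd; have [G' [Gp' Gd' GG']] := E _ Gp Gd.
have [h hP] := total_hom Gp' Gd'; exists h => k x y Ax Gxy.
by apply: (Gp'.2 _ _ _ _ (hP _ _)); exact: GG'.
Qed.

Definition graph (V K : sSet) (h : @hom sSet V K) : srel V K :=
  fun k x y => y = h k x.

Lemma graph_pmap V K (h : @hom sSet V K) : pmap (graph h).
Proof.
split=> [k l f x _ ->|k x _ _ -> ->] //.
by rewrite /graph hom_act.
Qed.

Lemma pull_pmap V V' K (u : @hom sSet V' V) (G : srel V K) : pmap G ->
  pmap (fun k x y => G k (u k x) y).
Proof.
move=> [Gs Gf]; split=> [k l f x y|k x y y']; last exact: Gf.
by rewrite hom_act; exact: Gs.
Qed.

Definition bdry n k (a : dhom k n) : Prop := exists i, forall x, a x <> i.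

Lemma bdry_comp n k l (a : dhom k n) (f : dhom l k) : bdry a -> bdry (dcomp a f).
Proof. by move=> [i ai]; exists i => x; exact: ai. Qed.

Definition coface n (i : 'I_n.+2) : dhom n n.+1.
Proof.
refine (@DHom n n.+1 (lift i) _).
by move=> x y xy; rewrite /= leq_bump2.
Defined.

Lemma codeg_mono n (j : nat) (x y : 'I_n.+2) : x <= y ->
  (@inord n (minn n (x - (j < x))) : nat) <= @inord n (minn n (y - (j < y))).
Proof. by move=> xy; rewrite !inordK; lia. Qed.

(** The truncation in [codeg_mono] takes effect only for [j] > [n], where it yields the collapse of
    the last two vertices. So [codeg n i] is a left inverse of [coface i] for every [i] up to n + 1,
    as [coface_factor] needs. *)
Definition codeg n (j : nat) : dhom n.+1 n := DHom (@codeg_mono n j).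

Lemma codegE n j (x : 'I_n.+2) : codeg n j x = minn n (x - (j < x)) :> nat.
Proof. by rewrite /= inordK; lia. Qed.

Lemma cofaceE n i (x : 'I_n.+1) : coface i x = x + (i <= x) :> nat.
Proof. by rewrite /= /bump; lia. Qed.

Lemma coface_factor k n (theta : dhom k n.+1) i : (forall x, theta x <> i) ->
  theta = dcomp (coface i) (dcomp (codeg n i) theta).
Proof.
move=> ti; apply: dhom_ext => x; apply: ord_inj.
rewrite [RHS]cofaceE dcompE codegE.
have /eqP := ti x; rewrite -val_eqE /=; have := ltn_ord (theta x); have := ltn_ord i.
lia.
Qed.

Lemma codeg_factor p q (psi : dhom p.+1 q) (a b : 'I_p.+2) : b = a.+1 :> nat ->
  psi a = psi b -> psi = dcomp (dcomp psi (coface b)) (codeg p a).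
Proof.
move=> ba ab; apply: dhom_ext => x; rewrite !dcompE.
case: (eqVneq x b) => [->|xb].
  rewrite -ab; congr (psi _); apply: ord_inj.
  rewrite [RHS](cofaceE b) codegE; have := ltn_ord b; lia.
congr (psi _); apply: ord_inj.
rewrite [RHS](cofaceE b) codegE; move: xb; rewrite -val_eqE /=.
have := ltn_ord b; have := ltn_ord x; lia.
Qed.

Lemma codeg_cofaceK p j : j <= p -> dcomp (codeg p j) (coface (inord j.+1)) = did p.
Proof.
move=> jp; apply: dhom_ext => x; apply: ord_inj.
rewrite [LHS]codegE cofaceE /= inordK; last by lia.
by have := ltn_ord x; lia.
Qed.

(** For monotone maps this is injectivity, in the form that directly negates the condition in
    [degen]. *)
Definition adj_inj p q (theta : dhom p q) :=
  forall a b : 'I_p.+1, b = a.+1 :> nat -> theta a <> theta b.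

Lemma adj_inj_ltn p q (theta : dhom p q) : adj_inj theta ->
  forall i j : 'I_p.+1, i <= j -> theta i + (j - i) <= theta j.
Proof.
move=> ti i j ij; have : j = i + (j - i) :> nat by rewrite subnKC.
move: (j - i) => d; elim: d j {ij} => [|d IH] j jE.
  by rewrite addn0 in jE; rewrite addn0 (ord_inj jE) leqnn.
have ud : i + d < p.+1 by have := ltn_ord j; lia.
have := IH (Ordinal ud) erefl; set u := Ordinal ud.
have ju : j = u.+1 :> nat by rewrite jE addnS.
have := dmono theta (_ : u <= j); rewrite ju leqnSn => /(_ isT).
have /eqP := ti u j ju; rewrite -val_eqE /=; lia.
Qed.

Lemma adj_inj_leq p q (theta : dhom p q) : adj_inj theta -> p <= q.
Proof.
move=> /adj_inj_ltn/(_ ord0 ord_max (leq0n _)) /=.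
by have := ltn_ord (theta ord_max); lia.
Qed.

Lemma adj_inj_id p (theta : dhom p p) : adj_inj theta -> theta = did p.
Proof.
move=> /adj_inj_ltn H; apply: dhom_ext => x; apply: ord_inj => /=.
have := H ord0 x (leq0n _); have := H x ord_max; rewrite /= -ltnS ltn_ord => /(_ isT).
by have := ltn_ord x; have := ltn_ord (theta ord_max); lia.
Qed.

(** The fibres of a monotone surjection are consecutive intervals, so choosing one point in each
    fibre is automatically monotone, and the choice over [theta x] is free. *)
Lemma section_through k p (theta : dhom k p) (x : 'I_k.+1) : ~ bdry theta ->
  exists2 s : dhom p k, dcomp theta s = did p & s (theta x) = x.
Proof.
move=> nb.
have sP i : {y | theta y = i}.
  by apply: cid; apply: contrapT => ny; apply: nb; exists i => y yi; apply: ny; exists y.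
pose s i := if i == theta x then x else projT1 (sP i).
have sK i : theta (s i) = i by rewrite /s; case: eqP => [->//|_]; case: (sP i).
have sm (i j : 'I_p.+1) : i <= j -> s i <= s j.
  rewrite leq_eqVlt => /orP[/eqP/val_inj->//|ij].
  rewrite leqNgt; apply/negP => /ltnW /(dmono theta); rewrite !sK; lia.
exists (DHom sm); first by apply: dhom_ext => i; exact: sK.
by rewrite /= /s eqxx.
Qed.

Section Skeleton.
Variable Y : functor (opC Delta) sSet.

Definition hact p q (theta : dhom q p) k (z : Y p k) : Y q k :=
  (@fmap (opC Delta) sSet Y p q theta : @hom sSet (Y p) (Y q)) k z.

Lemma hact1 p k (z : Y p k) : hact (did p) z = z.
Proof.
exact: (congr1 (fun h : natT (Y p) (Y p) => h k z) (@fmap1 (opC Delta) sSet Y p)).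
Qed.

Lemma hactM p q r (g : dhom q p) (f : dhom r q) k (z : Y p k) :
  hact f (hact g z) = hact (dcomp g f) z.
Proof.
rewrite /hact.
by rewrite [RHS](congr1 (fun h : natT (Y p) (Y r) => h k z) (@fmapM (opC Delta) sSet Y p q r f g)).
Qed.

Lemma hact_act p q (theta : dhom q p) k l (f : dhom l k) (z : Y p k) :
  hact theta (act f z) = act f (hact theta z).
Proof. exact: hom_act. Qed.

(* z is in the image of the a-th degeneracy for some a < j; for j = p these are
   all the degenerate simplices. *)
Definition degen (j p k : nat) (z : Y p k) := exists q (psi : dhom p q) (w : Y q k) (a b : 'I_p.+1),
  [/\ z = hact psi w, b = a.+1 :> nat, a < j & psi a = psi b].

Lemma degen_act j p k l (f : dhom l k) (z : Y p k) : degen j z -> degen j (act f z).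
Proof.
move=> [q [psi [w [a [b [-> ba aj ab]]]]]].
by exists q, psi, (act f w), a, b; rewrite hact_act.
Qed.

Lemma nondegen p q (psi : dhom p q) k (w : Y q k) :
  ~ degen p (hact psi w) -> adj_inj psi.
Proof.
move=> nd a b ba ab; apply: nd; exists q, psi, w, a, b; split=> //.
by have := ltn_ord b; lia.
Qed.

(** Uniqueness in the Eilenberg-Zilber lemma. A section s of [theta] gives z = (theta' s)^* z'; as z
    is nondegenerate, theta' s is injective, so p = q and theta' s is the identity. Sections through
    every vertex then force theta' = theta. *)
Lemma EZ_unique p q k (theta : dhom k p) (theta' : dhom k q) (z : Y p k) (z' : Y q k) :
  q <= p -> ~ bdry theta -> ~ degen p z -> hact theta z = hact theta' z' ->
  q = p /\ existT (fun p => (dhom k p * Y p k)%type) p (theta, z) =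
           existT (fun p => (dhom k p * Y p k)%type) q (theta', z').
Proof.
move=> qp nb nd E.
have sE s : dcomp theta s = did p -> z = hact (dcomp theta' s) z'.
  by move=> ts; rewrite -hactM -E hactM ts hact1.
have [s ts _] := section_through ord0 nb.
have /adj_inj_leq pq : adj_inj (dcomp theta' s).
  by apply: (@nondegen _ _ _ _ z'); rewrite -sE.
have {qp pq} e : q = p by apply/eqP; rewrite eqn_leq qp.
subst q; split=> //.
have tid s' : dcomp theta s' = did p -> dcomp theta' s' = did p.
  by move=> ts'; apply: adj_inj_id; apply: (@nondegen _ _ _ _ z'); rewrite -sE.
have -> : z = z' by rewrite (sE s ts) tid // hact1.
congr existT; congr pair; apply: dhom_ext => x.
have [s' ts' sx] := section_through x nb.
have := congr1 (fun u : dhom p p => u (theta x)) (tid _ ts').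
by rewrite /= sx.
Qed.

Variables (K : sSet) (A : forall p k, Y p k -> Prop).
Hypothesis Ah : forall p q (theta : dhom q p) k (z : Y p k), A z -> A (hact theta z).
Hypothesis Av : forall p k l (f : dhom l k) (z : Y p k), A z -> A (act f z).

(** [F p] is [A] together with the (p-1)-skeleton of the diagonal, viewed as the coend of Y_p x
    Delta[p]. [B p] is the part of the cell Y_p x Delta[p] along which it is attached. *)
Let F p k (y : diag Y k) : Prop := A (y : Y k k) \/
  exists q (theta : dhom k q) (w : Y q k), q < p /\ y = hact theta w.

Let B p : sub (prodS (Y p) (simplex p)) :=
  fun k x => (A x.1 \/ degen p x.1) \/ bdry x.2.

Lemma skel_F p k (x : prodS (Y p) (simplex p) k) :
  B x -> F p (hact x.2 x.1).
Proof.
case: x => z theta [[Az|[q [psi [w [a [b [zE ba ap ab]]]]]]]|[i ti]] /=.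
- by left; exact: Ah.
- case: p z theta a b psi zE ba ap ab => [|p] z theta a b psi /= zE ba ap ab; first by [].
  rewrite {}zE.
  right; exists p, (dcomp (codeg p a) theta), (hact (dcomp psi (coface b)) w).
  by split=> //; rewrite !hactM dcompA -codeg_factor.
- case: p z theta i ti => [|p] z theta i ti.
    by case: (ti ord0); rewrite (ord1 (theta _)) (ord1 i).
  right; exists p, (dcomp (codeg p i) theta), (hact (coface i) z).
  by split=> //; rewrite hactM -coface_factor.
Qed.

(** The cell is attached to [F p] along [B p] by a pushout: by [EZ_unique] a simplex of [F p.+1]
    outside [F p] comes from exactly one pair outside [B p], so the values of [H] there can be added
    to those of [G]. *)
Lemma skel_step p (G : srel (diag Y) K) :
  ext (@B p) (@sall _) K -> pmap G -> defined_on G (@F p) ->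
  exists G' : srel (diag Y) K, [/\ pmap G', defined_on G' (@F p.+1) &
    forall k x y, F p x -> G k x y -> G' k x y].
Proof.
move=> E [Gs Gf] Gd.
pose G1 : srel (prodS (Y p) (simplex p)) K := fun k x y => G k (hact x.2 x.1) y.
have actE k l (f : dhom l k) (z : Y p k) (theta : dhom k p) :
  hact (dcomp theta f) (act f z) = act (f : dhom l k) (hact theta z : diag Y k).
  by rewrite -hactM hact_act.
have G1p : pmap G1.
  split=> [k l f [z theta] y|k x y y'] ; last exact: Gf.
  by rewrite /G1 /= actE; exact: Gs.
have Fact k l (f : dhom l k) (x : diag Y k) : F p x -> F p (act f x).
  case=> [Ax|[q [theta [w [qp ->]]]]].
    by left; apply: Ah; exact: Av.
  right; exists q, (dcomp theta f), (act f w); split=> //.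
  by rewrite -hactM hact_act.
have G1d : defined_on G1 (@B p) by move=> k x /skel_F/Gd.
have [H [[Hs Hf] Hd GH]] := E _ G1p G1d.
exists (fun k (x : diag Y k) y => (F p x /\ G k x y) \/
  exists z theta, [/\ x = hact theta z, ~ @B p k (z, theta) & H k (z, theta) y]).
split; first split.
- move=> k l f x y [[Fx Gxy]|[z [theta [xE nB Hy]]]].
    by left; split; [exact: Fact|exact: Gs].
  have xfE : act f x = hact (dcomp theta f) (act f z) by rewrite xE actE.
  have {}Hy := Hs _ _ f _ _ Hy.
  (* A face of a new simplex may be old; there [H] takes the value of [G], because it extends [G1]
     on [B p]. *)
  case: (pselect (@B p l (act f z, dcomp theta f))) => [Bz|nB'].
    left; split; first by rewrite xfE; exact: (skel_F Bz).
    have [y' Gy'] := G1d _ _ Bz.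
    by rewrite (Hf _ _ _ _ Hy (GH _ _ _ Bz Gy')) xfE.
  by right; exists (act f z), (dcomp theta f).
- have key k (z : Y p k) (theta : dhom k p) : ~ @B p k (z, theta) -> ~ F p (hact theta z).
    move=> nB; have nA : ~ A z by move=> ?; apply: nB; left; left.
    have nd : ~ degen p z by move=> ?; apply: nB; left; right.
    have nb : ~ bdry theta by move=> ?; apply: nB; right.
    case=> [Az|[q [theta' [w [qp e]]]]].
      have [s ts _] := section_through ord0 nb.
      by apply: nA; rewrite -(hact1 z) -ts -hactM; exact: Ah.
    have [qe _] := EZ_unique (ltnW qp) nb nd e.
    by rewrite qe ltnn in qp.
  move=> k x y y' [[Fx Gy]|[z [theta [xE nB Hy]]]] [[Fx' Gy']|[z' [theta' [xE' nB' Hy']]]].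
  + exact: Gf Gy Gy'.
  + by case: (key _ _ _ nB'); rewrite -xE'.
  + by case: (key _ _ _ nB); rewrite -xE.
  + have nd : ~ degen p z by move=> ?; apply: nB; left; right.
    have nb : ~ bdry theta by move=> ?; apply: nB; right.
    have := EZ_unique (leqnn p) nb nd (etrans (esym xE) xE').
    move=> [_ e0]; have e := existT_inj e0; have [tt zz] : theta = theta' /\ z = z' by case: e.
    by rewrite -tt -zz in Hy'; exact: Hf Hy Hy'.
- move=> k x Fx.
  case: (pselect (F p x)) => [Fx'|nF]; first by have [y] := Gd _ _ Fx'; exists y; left.
  case: Fx => [Ax|[q [theta [w [qp xE]]]]]; first by case: nF; left.
  have qe : q = p.
    apply/eqP; rewrite eqn_leq -ltnS qp /= leqNgt; apply/negP => qp'.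
    by apply: nF; right; exists q, theta, w.
  subst q; have [y Hy] := Hd k (w, theta) I.
  exists y; right; exists w, theta; split=> // /skel_F /=.
  by rewrite -xE.
- by move=> k x y Fx Gy; left.
Qed.

Lemma skel_ext : (forall p, ext (@B p) (@sall _) K) ->
  ext (fun k (y : diag Y k) => A (y : Y k k)) (@sall (diag Y)) K.
Proof.
move=> E G Gp Gd.
pose st p := {G : srel (diag Y) K | pmap G /\ defined_on G (@F p)}.
have step p (G0 : st p) : {G' : st p.+1 |
    forall k x y, F p x -> projT1 G0 k x y -> projT1 G' k x y}.
  apply: cid; case: G0 => G2 [Gp2 Gd2].
  by have [G' [p1 p2 p3]] := skel_step (E p) Gp2 Gd2; exists (exist _ G' (conj p1 p2)).
have G0 : defined_on G (@F 0).
  by move=> k x [Ax|[q [theta [w []]]]]; [exact: Gd|rewrite ltn0].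
pose st0 : st 0 := exist _ G (conj Gp G0).
pose fix S p : st p := if p is p'.+1 then projT1 (step p' (S p')) else st0.
have Sp p : pmap (projT1 (S p)) by case: (S p) => ? [].
have Sd p : defined_on (projT1 (S p)) (@F p) by case: (S p) => ? [].
have F_le p q k (x : diag Y k) : p <= q -> F p x -> F q x.
  move=> pq [Ax|[r [theta [w [rp xE]]]]]; [by left|right].
  by exists r, theta, w; split=> //; exact: leq_trans pq.
have SS p q k (x : diag Y k) y : p <= q -> F p x ->
    projT1 (S p) k x y -> projT1 (S q) k x y.
  move=> /subnKC <-; elim: (q - p) => [|d IH] Fx Sy; first by rewrite addn0.
  rewrite addnS /=; case: (step _ _) => G' /= P; apply: P; last exact: IH.
  by apply: F_le Fx; exact: leq_addr.
(* A k-simplex of the diagonal is its own pullback along the identity of [k], hence is present from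
   stage k + 1 on, with a value that no longer changes. *)
have Fk k (x : diag Y k) : F k.+1 x.
  by right; exists k, (did k), x; rewrite hact1.
exists (fun k x y => projT1 (S k.+1) k x y); split; first split.
- move=> k l f x y Sy.
  have {}Sy := (Sp k.+1).1 _ _ f _ _ Sy.
  have Fx : F k.+1 (act f x).
    by right; exists k, f, (@act (Y k) k l f x).
  have [y' Sy'] := Sd _ _ _ (Fk l (act f x)).
  have a1 := SS _ (maxn k.+1 l.+1) _ _ _ (leq_maxl _ _) Fx Sy.
  have a2 := SS _ (maxn k.+1 l.+1) _ _ _ (leq_maxr _ _) (Fk l (act f x)) Sy'.
  by rewrite ((Sp _).2 _ _ _ _ a1 a2).
- by move=> k x y y'; exact: (Sp k.+1).2.
- by move=> k x _; apply: Sd; exact: Fk.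
- by move=> k x y Ax Gy; apply: (SS 0) => //; left.
Qed.

End Skeleton.

(** * Prisms *)

Lemma Kan_ext (K : sSet) n (i : 'I_n.+2) : Kan K ->
  ext (fun k (x : simplex n.+1 k) => in_horn i x) (@sall (simplex n.+1)) K.
Proof.
move=> kK G Gp Gd.
have Gd' : defined_on (fun k x y => G k (horn_incl i k x) y) (@sall (horn i)).
  by move=> k [x xi] _; exact: Gd.
have [s sP] := total_hom (pull_pmap (horn_incl i) Gp) Gd'.
have [t ts] := kK _ i s.
exists (graph t); split; [exact: graph_pmap|by move=> k x _; exists (t k x)|].
move=> k x y xi Gxy; apply: (Gp.2 _ _ _ _ Gxy).
have := sP k (exist _ x xi).
by rewrite -[s]ts.
Qed.

Section Prism.
Variables (K : sSet) (n : nat).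
Hypothesis kK : Kan K.

Local Notation D := (prodS (simplex n) (simplex 1)).

Lemma tau_mono (i : nat) (x y : 'I_n.+2) : x <= y ->
  (@inord 1 (i < x) : nat) <= @inord 1 (i < y).
Proof. by move=> xy; rewrite !inordK; lia. Qed.

Let tau i : dhom n.+1 1 := DHom (@tau_mono i).

Let tauE i x : tau i x = (i < x) :> nat.
Proof. by rewrite /= inordK; lia. Qed.

Let u_nat i k l (f : dhom l k) (x : simplex n.+1 k) :
  ((dcomp (codeg n i) (act f x), dcomp (tau i) (act f x)) : D l) =
  act f ((dcomp (codeg n i) x, dcomp (tau i) x) : D k).
Proof. by congr pair; rewrite [RHS]/(dcomp _ _) -dcompA. Qed.

Let u i : @hom sSet (simplex n.+1) D :=
  mkS (X := simplex n.+1) (Y := D) (@u_nat i).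

Let u1E i k (x : simplex n.+1 k) v :
  (u i k x).1 v = minn n ((x : dhom k n.+1) v - (i < (x : dhom k n.+1) v)) :> nat.
Proof. exact: codegE. Qed.

Let u2E i k (x : simplex n.+1 k) v :
  (u i k x).2 v = (i < (x : dhom k n.+1) v) :> nat.
Proof. exact: tauE. Qed.

(* The chain (0,0) < .. < (j,0) < (j,1) < .. < (n,1) of the prism. *)
Let below j k (x : D k) :=
  forall v, (x.2 v = 0 :> nat -> x.1 v <= j) /\ (0 < x.2 v -> j <= x.1 v).

Let base : sub D := fun k x => bdry x.1 \/ x.2 = dconst k ord0.

(** The top-dimensional simplices of the prism are attached to the base in the order n, n - 1, ..,
    0. *)
Let P i : sub D := fun k x => base x \/ exists j, i <= j <= n /\ below j x.

Let P_closed i : sclosed (P i).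
Proof.
move=> k l f [a t] [[ab|/= tE]|[j [ij b]]].
- by left; left; exact: bdry_comp.
- by left; right; rewrite /= tE; exact: act_dconst.
- by right; exists j; split=> // v; exact: (b (f v)).
Qed.

(** Face i of simplex i is shared with simplex i - 1 (or is the top, for i = 0) and is still
    missing. Face i + 1 is shared with simplex i + 1 (or is the bottom, for i = n) and is present.
    Every other face projects into the boundary of Delta[n]. *)
Let u_horn i k (x : simplex n.+1 k) : i <= n ->
  @P i.+1 k (u i k x) <-> in_horn (inord i : 'I_n.+2) x.
Proof.
move=> le_in; have iK : (inord i : 'I_n.+2) = i :> nat by rewrite inordK; lia.
have xv v : x v < n.+2 by exact: ltn_ord.
split.
- have miss m : m < n.+2 -> m != i -> (forall v, x v <> m :> nat) -> in_horn (inord i : 'I_n.+2) x.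
    move=> mn mi xm; exists (Ordinal mn); split.
      by move=> /(congr1 (@nat_of_ord _)) /=; rewrite iK; lia.
    by move=> v /(congr1 (@nat_of_ord _)); exact: xm.
  case=> [[[m xm]|tE]|[j [/andP[ij jn] b]]].
  + have mn := ltn_ord m.
    apply: (miss (m + (i <= m))); [lia|lia|move=> v xvE].
    apply: (xm v); apply: ord_inj; rewrite u1E xvE; lia.
  + apply: (miss n.+1); [lia|lia|move=> v xvE].
    have := congr1 (fun t : dhom k 1 => nat_of_ord (t v)) tE.
    rewrite u2E xvE /=; lia.
  + apply: (miss i.+1); [lia|lia|move=> v xvE].
    have [_] := b v; rewrite u1E u2E xvE; lia.
- move=> [m [mi xm]].
  have {}mi : m <> i :> nat by move=> e; apply: mi; apply: ord_inj; rewrite iK.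
  have {}xm v : x v <> m :> nat by move=> e; apply: (xm v); exact: ord_inj.
  have mn := ltn_ord m.
  case: (eqVneq (m : nat) i.+1) => [mE|mi'].
    case: (eqVneq i n) => [iE|ni].
      left; right; apply: dhom_ext => v; apply: ord_inj.
      by rewrite u2E /=; have := xm v; have := xv v; lia.
    right; exists i.+1; split; first by lia.
    move=> v; rewrite u1E u2E.
    by have := xm v; have := xv v; lia.
  have mn' : m - (i < m) < n.+1 by lia.
  left; left; exists (Ordinal mn') => v /(congr1 (@nat_of_ord _)).
  rewrite u1E /=; have := xm v; have := xv v; lia.
Qed.

Let u_inj i k (x y : simplex n.+1 k) : i <= n -> u i k x = u i k y -> x = y.
Proof.
move=> le_in e; apply: dhom_ext => v; apply: ord_inj.
have := congr1 (fun z : D k => nat_of_ord (z.1 v)) e.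
have := congr1 (fun z : D k => nat_of_ord (z.2 v)) e.
rewrite !u1E !u2E.
by have := ltn_ord (x v); have := ltn_ord (y v); lia.
Qed.

Let u_surj i k (z : D k) : i <= n -> below i z -> exists x, z = u i k x.
Proof.
case: z => a t le_in b.
have tv v : t v < 2 by exact: ltn_ord.
have av v : a v < n.+1 by exact: ltn_ord.
(* In the i-th chain the vertex (a, t) stands at position a + t. *)
have xm (v w : 'I_k.+1) : v <= w ->
    (@inord n.+1 (a v + t v) : nat) <= @inord n.+1 (a w + t w).
  move=> vw; have := dmono a vw; have := dmono t vw.
  rewrite !inordK; first 1 last; [| |lia].
    by have := tv w; have := av w; lia.
  by have := tv v; have := av v; lia.
have xE v : DHom xm v = a v + t v :> nat.
  by rewrite /= inordK //; have := tv v; have := av v; lia.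
exists (DHom xm); congr pair; apply: dhom_ext => v; apply: ord_inj.
  rewrite [RHS]codegE xE; have /= := b v; have := tv v; have := av v; lia.
rewrite [RHS]tauE xE; have /= := b v; have := tv v; have := av v; lia.
Qed.

Let prism_step i (G : srel D K) : i <= n -> pmap G -> defined_on G (P i.+1) ->
  exists G' : srel D K, [/\ pmap G', defined_on G' (P i) &
    forall k x y, P i.+1 x -> G k x y -> G' k x y].
Proof.
move=> le_in Gp Gd.
have Gd' : defined_on (fun k x y => G k (u i k x) y) (fun k x => in_horn (inord i) x).
  by move=> k x /(u_horn _ le_in); exact: Gd.
have [h hP] := ext_hom (Kan_ext kK) (pull_pmap (u i) Gp) Gd'.
exists (fun k z y => (P i.+1 z /\ G k z y) \/ exists2 x, z = u i k x & y = h k x).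
split; first split.
- move=> k l f z y [[Pz Gz]|[x -> ->]].
    by left; split; [exact: P_closed|exact: Gp.1].
  by right; exists (act f x); rewrite hom_act.
- have key k x y : P i.+1 (u i k x) -> G k (u i k x) y -> y = h k x.
    by move=> /(u_horn _ le_in) hx Gy; rewrite (hP _ _ _ hx Gy).
  move=> k z y y' [[Pz Gz]|[x zE ->]] [[Pz' Gz']|[x' zE' ->]].
  + exact: Gp.2 Gz Gz'.
  + by apply: key; rewrite -zE'.
  + by apply/esym/key; rewrite -zE.
  + by congr (h k _); apply: (u_inj le_in); rewrite -zE.
- move=> k z [bz|[j [/andP[ij jn] b]]].
    have Pz : P i.+1 z by left.
    by have [y Gy] := Gd _ _ Pz; exists y; left.
  case: (eqVneq i j) => [e|ne].
    by subst j; have [x xE] := u_surj jn b; exists (h k x); right; exists x.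
  have Pz : P i.+1 z by right; exists j; split=> //; lia.
  by have [y Gy] := Gd _ _ Pz; exists y; left.
- by move=> k z y Pz Gz; left.
Qed.

Lemma prism_ext : ext (fun k (x : D k) => bdry x.1 \/ x.2 = dconst k ord0) (@sall D) K.
Proof.
move=> G Gp Gd.
have H d : d <= n.+1 -> exists G' : srel D K, [/\ pmap G', defined_on G' (P (n.+1 - d)) &
    forall k x y, base x -> G k x y -> G' k x y].
  elim: d => [_|d IH dn].
    exists G; split=> // k x [bx|[j [jn _]]]; [exact: Gd|lia].
  have [|G1 [p1 d1 e1]] := IH; first by lia.
  have nd : n.+1 - d = (n.+1 - d.+1).+1 by lia.
  rewrite nd in d1.
  have [|G2 [p2 d2 e2]] := prism_step _ p1 d1; first by lia.
  exists G2; split=> // k x y bx Gx; apply: e2; [by left|exact: e1].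
have [G' [p' d' e']] := H n.+1 (leqnn _); rewrite subnn in d'.
exists G'; split=> // k [a t] _; apply: d'.
(* The chain through a given simplex changes level at the first coordinate of its earliest vertex
   over the end 1; if there is no such vertex, the simplex lies in the bottom. *)
case: (pselect (exists j : nat, [exists v : 'I_k.+1, (0 < t v) && (a v == j :> nat)])).
  move=> /ex_minnP[j /existsP[v /andP[tv /eqP aj]] jmin].
  right; exists j; split; first by have := ltn_ord (a v); lia.
  move=> w /=; split=> tw.
    rewrite leqNgt; apply/negP => jw.
    case: (leqP v w) => [vw|/ltnW wv].
      by have := dmono t vw; lia.
    by have := dmono a wv; lia.
  by apply: jmin; apply/existsP; exists w; rewrite tw eqxx.
move=> nj; left; right; apply: dhom_ext => v; apply: ord_inj => /=.
apply/eqP; rewrite -leqn0 leqNgt; apply/negP => tv; apply: nj.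
by exists (a v); apply/existsP; exists v; rewrite tv eqxx.
Qed.

End Prism.

(** * Homotopy extension and function complexes *)

Definition hep (e : 'I_2) (K : sSet) := forall (V : sSet) (U : sub V), sclosed U ->
  ext (fun k (x : prodS V (simplex 1) k) => U k x.1 \/ x.2 = dconst k e)
      (@sall (prodS V (simplex 1))) K.

Section HomotopyExtension.
Variables (K V : sSet) (U : sub V).
Hypotheses (kK : Kan K) (Ucl : sclosed U).

(** With V_p taken as a discrete simplicial set, the diagonal of p |-> V_p x Delta[1] is V x
    Delta[1]. The skeletal induction thus becomes the classical one over the simplices of V, with
    prisms as cells. *)
Let Yob p : sSet := prodS (@constF (opC Delta) TypeC (V p)) (simplex 1).

Let Yhom p q (theta : dhom q p) : @hom sSet (Yob p) (Yob q) :=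
  @mkS (Yob p) (Yob q) (fun k x => (act theta x.1, x.2)) (fun _ _ _ _ => erefl).

Let Y : functor (opC Delta) sSet.
Proof.
refine (@Functor (opC Delta) sSet Yob Yhom _ _).
- by move=> p; apply: natT_ext => k; apply: funext => -[z t] /=; rewrite act1.
- by move=> p q r g f; apply: natT_ext => k; apply: funext => -[z t] /=; rewrite -actM.
Defined.

Lemma hep0_ext : ext (fun k (x : prodS V (simplex 1) k) => U x.1 \/ x.2 = dconst k ord0)
  (@sall (prodS V (simplex 1))) K.
Proof.
apply: (@skel_ext Y K (fun p k z => U z.1 \/ z.2 = dconst k ord0)).
- by move=> p q theta k [z t] /= [Uz|->]; [left; exact: Ucl|right].
- by move=> p k l f [z t] /= [Uz|->]; [left|right; exact: act_dconst].
(* Over z in [U] or degenerate, the whole cell already lies in the domain and keeps the values of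
   [G]. Over each other z a prism is filled, independently of the rest. *)
move=> p; pose Q (z : V p) := U z \/ exists q (psi : dhom p q) (w : V q) (a b : 'I_p.+1),
  [/\ z = act psi w, b = a.+1 :> nat, a < p & psi a = psi b].
move=> G Gp Gd.
pose Gz (z : V p) : srel (prodS (simplex p) (simplex 1)) K :=
  fun k x y => G k ((z, x.2), x.1) y.
have Gzp z : pmap (Gz z).
  split=> [k l f [a t] y|k x y y']; last exact: Gp.2.
  exact: (Gp.1 k l f ((z, t), a)).
have Gzd z : defined_on (Gz z) (fun k x => bdry x.1 \/ x.2 = dconst k ord0).
  by move=> k [a t] /= [ba|t0]; apply: Gd; [right|left; left; right].
have hz z := cid (ext_hom (prism_ext (n := p) kK) (Gzp z) (Gzd z)).
have GQ k (z : V p) t a : Q z -> exists y, G k ((z, t), a) y.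
  move=> [Uz|[q [psi [w [i [j [zE ji ip ij]]]]]]]; apply: Gd; left.
    by left; left.
  right; exists q, psi, (w, t), i, j; split=> //.
  by rewrite /= zE.
exists (fun k x y => (Q x.1.1 /\ G k x y) \/
  ~ Q x.1.1 /\ y = projT1 (hz x.1.1) k (x.2, x.1.2)); split; first split.
- move=> k l f [[z t] a] y /= [[Qz Gx]|[nQ ->]].
    by left; split=> //; exact: (Gp.1 k l f ((z, t), a)).
  by right; split=> //; exact: (esym (hom_act (projT1 (hz z)) f (a, t))).
- move=> k x y y' [[Qz Gx]|[nQ yE]] [[Qz' Gx']|[nQ' yE']] //.
    exact: Gp.2 Gx Gx'.
  by rewrite yE.
- move=> k [[z t] a] _ /=; case: (pselect (Q z)) => Qz.
    by have [y Gy] := GQ k z t a Qz; exists y; left.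
  by exists (projT1 (hz z) k (a, t)); right.
- move=> k [[z t] a] y /= Bx Gx.
  case: (pselect (Q z)) => Qz; [by left|right; split=> //].
  case: (hz z) => h hP /=; apply/esym/hP => //=.
  case: Bx => [[[Uz|t0]|[q [psi [w [i [j [zE ji ip ij]]]]]]]|ba]; try by [left|right].
    by case: Qz; left.
  case: Qz; right; exists q, psi, w.1, i, j; split=> //.
  by rewrite -[z]/((z, t).1) zE.
Qed.

End HomotopyExtension.

Lemma Kan_hep0 K : Kan K -> hep ord0 K.
Proof. by move=> kK V U Uc; exact: hep0_ext. Qed.

Lemma drev_mono m n (f : dhom m n) (i j : 'I_m.+1) :
  i <= j -> rev_ord (f (rev_ord i)) <= rev_ord (f (rev_ord j)).
Proof.
move=> ij; have := dmono f (_ : rev_ord j <= rev_ord i).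
by rewrite /= => H; apply: leq_sub2l; rewrite ltnS; apply: H; lia.
Qed.

(** The involution of Delta that reverses every [n]. It exchanges the ends of Delta[1], so homotopy
    extension from the end 1 is homotopy extension from the end 0 for opposite simplicial sets. *)
Definition drev m n (f : dhom m n) : dhom m n := DHom (drev_mono f).

Lemma drevK m n (f : dhom m n) : drev (drev f) = f.
Proof. by apply: dhom_ext => i /=; rewrite !rev_ordK. Qed.

Lemma drevM m n p (g : dhom n p) (f : dhom m n) :
  drev (dcomp g f) = dcomp (drev g) (drev f).
Proof. by apply: dhom_ext => i /=; rewrite !rev_ordK. Qed.

Lemma drev1 m : drev (did m) = did m.
Proof. by apply: dhom_ext => i /=; rewrite !rev_ordK. Qed.

Lemma drev_dconst m n (i : 'I_n.+1) : drev (@dconst m n i) = @dconst m n (rev_ord i).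
Proof. exact: dhom_ext. Qed.

Definition opS (X : sSet) : sSet.
Proof.
refine (@Functor (opC Delta) TypeC X (fun k l (f : dhom l k) x => act (drev f) x) _ _).
- by move=> k; apply: funext => x; rewrite /= drev1 act1.
- by move=> k l m g f; apply: funext => x; rewrite /= drevM actM.
Defined.

Lemma in_horn_drev n (k : 'I_n.+1) l (x : dhom l n) :
  in_horn k x -> in_horn (rev_ord k) (drev x).
Proof.
move=> [i [ik xi]]; exists (rev_ord i); split.
  by move=> /rev_ord_inj.
by move=> j /= /rev_ord_inj; exact: xi.
Qed.

Lemma Kan_op K : Kan K -> Kan (opS K).
Proof.
move=> kK n k s.
pose hrev l (x : horn (rev_ord k) l) : horn k l :=
  exist _ (drev (proj1_sig x)) (eq_ind _ (fun j => in_horn j (drev (proj1_sig x)))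
     (in_horn_drev (proj2_sig x)) _ (rev_ordK k)).
have sn l m (f : dhom m l) (x : horn (rev_ord k) l) :
    (s m (hrev m (act f x)) : K m) = act f (s l (hrev l x) : K l).
  have -> : hrev m (act f x) = act (drev f) (hrev l x).
    by apply: eq_exist; rewrite /= drevM.
  by rewrite hom_act [LHS]/(act (drev (drev f)) _) drevK.
have [t ts] := kK n (rev_ord k) (mkS (X := horn (rev_ord k)) (Y := K) sn).
have tn l m (f : dhom m l) (x : simplex n.+1 l) :
    (t m (drev (act f x)) : opS K m) = act f (t l (drev x) : opS K l).
  have -> : drev (act f x) = @act (simplex n.+1) _ _ (drev f) (drev x) by exact: drevM.
  exact: (hom_act t (drev f) (drev x : simplex n.+1 l)).
exists (mkS (X := simplex n.+1) (Y := opS K) tn).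
apply: natT_ext => l; apply: funext => -[x xk] /=.
have xk' : in_horn (rev_ord k) (drev x) by exact: in_horn_drev.
have := congr1 (fun h : natT (horn (rev_ord k)) K => h l (exist _ (drev x) xk')) ts.
move=> /= ->; congr (s l _); apply: eq_exist.
by rewrite drevK.
Qed.

Lemma Kan_hep1 K : Kan K -> hep ord_max K.
Proof.
move=> /Kan_op/Kan_hep0 H V U Ucl G Gp Gd.
have Ucl' : @sclosed (opS V) U by move=> k l f x; exact: Ucl.
pose G1 : srel (prodS (opS V) (simplex 1)) (opS K) := fun k x y => G k (x.1, drev x.2) y.
have G1p : pmap G1.
  split=> [k l f [z t] y Gx|k x y y']; last exact: Gp.2.
  have : G l (@act V _ _ (drev f) z, dcomp (drev t) (drev f)) (@act K _ _ (drev f) y).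
    exact: (Gp.1 k l (drev f) (z, drev t) y Gx).
  by rewrite -drevM.
have rev0 : rev_ord (ord0 : 'I_2) = ord_max by apply: ord_inj.
have G1d : defined_on G1 (fun k x => U k x.1 \/ x.2 = dconst k ord0).
  move=> k [z t] /= [Uz|->]; apply: Gd; [by left|right].
  by rewrite /= drev_dconst rev0.
have [G' [p' d' e']] := H (opS V) U Ucl' G1 G1p G1d.
exists (fun k x y => G' k (x.1, drev x.2) y); split; first split.
- move=> k l f [z t] y Gx.
  have : G' l (@act V _ _ (drev (drev f)) z, dcomp (drev t) (drev f))
      (@act K _ _ (drev (drev f)) y).
    exact: (p'.1 k l (drev f) (z, drev t) y Gx).
  by rewrite -drevM drevK.
- by move=> k x y y'; exact: p'.2.
- by move=> k x _; exact: d'.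
- move=> k [z t] y /= Bx Gx; apply: e'; last by rewrite /G1 /= drevK.
  case: Bx => [Uz|->]; [by left|right].
  by rewrite /= drev_dconst -rev0 rev_ordK.
Qed.

(** A homotopy [r] that preserves the horn, is the identity at [e'] and lands in the horn at [e]
    makes the horn inclusion a retract of a homotopy extension problem; the factor Z is carried
    along. *)
Lemma hornZ_ext_retract (e e' : 'I_2) (K Z : sSet) n (k : 'I_n.+1)
  (r : @hom sSet (prodS (simplex n) (simplex 1)) (simplex n)) :
  hep e K ->
  (forall l (a : dhom l n), r l (a, dconst l e') = a) ->
  (forall l (a : dhom l n), in_horn k (r l (a, dconst l e) : dhom l n)) ->
  (forall l (a : dhom l n) t, in_horn k a -> in_horn k (r l (a, t) : dhom l n)) ->
  ext (fun l (x : prodS Z (simplex n) l) => in_horn k x.2) (@sall (prodS Z (simplex n))) K.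
Proof.
move=> H r1 r2 r3 G Gp Gd.
have rn l m (f : dhom m l) (x : prodS (prodS Z (simplex n)) (simplex 1) l) :
  ((act f x).1.1, r m ((act f x).1.2, (act f x).2)) =
   act f ((x.1.1, r l (x.1.2, x.2)) : prodS Z (simplex n) l).
  by congr pair; rewrite -[RHS](hom_act r f).
pose R := mkS (X := prodS (prodS Z (simplex n)) (simplex 1)) (Y := prodS Z (simplex n)) rn.
have Gd' : defined_on (fun l x y => G l (R l x) y)
    (fun l x => in_horn k x.1.2 \/ x.2 = dconst l e).
  by move=> l [[z a] t] /= [ka|->]; apply: Gd; [exact: r3|exact: r2].
have Ucl : sclosed (fun l (x : prodS Z (simplex n) l) => in_horn k x.2).
  by move=> l m f [z a]; exact: in_horn_comp.
have [G' [p' d' e'']] := H _ _ Ucl _ (pull_pmap R Gp) Gd'.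
exists (fun l x y => G' l (x, dconst l e') y); split; first split.
- move=> l m f x y Gx.
  have : G' m (act f x, dcomp (dconst l e') f) (act f y).
    exact: (p'.1 l m f (x, dconst l e') y Gx).
  by rewrite act_dconst.
- by move=> l x y y'; exact: p'.2.
- by move=> l x _; exact: d'.
- by move=> l [z a] y /= ka Gx; apply: e''; [left|rewrite /= r1].
Qed.

Section HornRetraction.
Variables (n : nat) (k : 'I_n.+1) (low : bool).

(** If [low], this moves from min(-, k) to the identity, otherwise from the identity to max(-, k).
    All values are old values or k, so the horn is preserved. The first needs k < n, to miss the
    vertex n; the second needs k > 0, to miss the vertex 0. *)
Definition hr_fun l (x : prodS (simplex n) (simplex 1) l) (v : 'I_l.+1) : nat :=
  if low then (if x.2 v == ord0 then minn (x.1 v) k else x.1 v)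
  else (if x.2 v == ord0 then x.1 v : nat else maxn (x.1 v) k).

Lemma hr_fun_lt l x v : @hr_fun l x v < n.+1.
Proof.
by rewrite /hr_fun; have := ltn_ord (x.1 v); have := ltn_ord k; case: low; case: eqP; lia.
Qed.

Lemma hr_mono l (x : prodS (simplex n) (simplex 1) l) (v w : 'I_l.+1) : v <= w ->
  (@inord n (hr_fun x v) : nat) <= @inord n (hr_fun x w).
Proof.
move=> vw; rewrite !inordK ?hr_fun_lt //.
have := dmono x.1 vw; have := dmono x.2 vw; rewrite /hr_fun -!val_eqE /=.
by case: low; case: eqP; case: eqP; lia.
Qed.

Lemma hr_nat l m (f : dhom m l) (x : prodS (simplex n) (simplex 1) l) :
  (DHom (@hr_mono m (act f x)) : simplex n m) = act f (DHom (@hr_mono l x) : simplex n l).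
Proof. exact: dhom_ext. Qed.

Definition horn_retraction : @hom sSet (prodS (simplex n) (simplex 1)) (simplex n) :=
  mkS (X := prodS (simplex n) (simplex 1)) (Y := simplex n) hr_nat.

Lemma horn_retractionE l (x : prodS (simplex n) (simplex 1) l) (v : 'I_l.+1) :
  (horn_retraction l x : dhom l n) v = hr_fun x v :> nat.
Proof. by rewrite /= inordK ?hr_fun_lt. Qed.

Lemma horn_retraction_horn l (a : dhom l n) t :
  in_horn k a -> in_horn k (horn_retraction l (a, t) : dhom l n).
Proof.
move=> [i [ik ai]]; exists i; split=> // v /(congr1 (@nat_of_ord _)).
rewrite horn_retractionE /hr_fun /= => E.
have {}ai : a v <> i :> nat by move=> ?; apply: (ai v); exact: ord_inj.
have {}ik : i <> k :> nat by move=> ?; apply: ik; exact: ord_inj.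
by move: E; case: low; case: eqP; lia.
Qed.

End HornRetraction.

Lemma hornZ_ext (K Z : sSet) n (k : 'I_n.+2) : Kan K ->
  ext (fun l (x : prodS Z (simplex n.+1) l) => in_horn k x.2)
      (@sall (prodS Z (simplex n.+1))) K.
Proof.
move=> kK; case: (ltnP k n.+1) => kn.
- apply: (@hornZ_ext_retract ord0 ord_max _ _ _ _ (horn_retraction k true)) => //.
  + exact: Kan_hep0.
  + by move=> l a; apply: dhom_ext => v; apply: ord_inj; rewrite horn_retractionE.
  + move=> l a; exists ord_max; split.
      by move=> /(congr1 (@nat_of_ord _)) /=; lia.
    move=> v /(congr1 (@nat_of_ord _)); rewrite horn_retractionE /hr_fun /=; lia.
  + by move=> l a t; exact: horn_retraction_horn.
- apply: (@hornZ_ext_retract ord_max ord0 _ _ _ _ (horn_retraction k false)) => //.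
  + exact: Kan_hep1.
  + by move=> l a; apply: dhom_ext => v; apply: ord_inj; rewrite horn_retractionE.
  + move=> l a; exists ord0; split.
      by move=> /(congr1 (@nat_of_ord _)) /=; lia.
    move=> v /(congr1 (@nat_of_ord _)); rewrite horn_retractionE /hr_fun /=; lia.
  + by move=> l a t; exact: horn_retraction_horn.
Qed.

Definition exp_simplex (Z K : sSet) (k : nat) : Type :=
  {phi : forall l : nat, Z l * dhom l k -> K l | forall l m (f : dhom m l) z theta,
     phi m (act f z, dcomp theta f) = act f (phi l (z, theta))}.

Lemma exp_act_nat (Z K : sSet) k m (g : dhom m k) (phi : exp_simplex Z K k) :
  forall l l' (f : dhom l' l) (z : Z l) (theta : dhom l m),
  proj1_sig phi l' (act f z, dcomp g (dcomp theta f)) =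
  act f (proj1_sig phi l (z, dcomp g theta)).
Proof. by move=> l l' f z theta; rewrite dcompA (proj2_sig phi). Qed.

Definition exp_act (Z K : sSet) k m (g : dhom m k) (phi : exp_simplex Z K k) :
  exp_simplex Z K m :=
  exist _ (fun l x => proj1_sig phi l (x.1, dcomp g x.2)) (exp_act_nat g phi).

Lemma exp_ext (Z K : sSet) k (phi psi : exp_simplex Z K k) :
  (forall l z theta, proj1_sig phi l (z, theta) = proj1_sig psi l (z, theta)) ->
  phi = psi.
Proof.
case: phi psi => [phi p] [psi q] /= E; apply: eq_exist.
by apply: functional_extensionality_dep => l; apply: funext => -[z theta].
Qed.

Definition expS (Z K : sSet) : sSet.
Proof.
refine (@Functor (opC Delta) TypeC (exp_simplex Z K) (@exp_act Z K) _ _).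
- move=> k; apply: funext => phi; apply: exp_ext => l z theta /=.
  by congr (proj1_sig phi l (z, _)); exact: dhom_ext.
- move=> k l m g f; apply: funext => phi; apply: exp_ext => l' z theta /=.
  by congr (proj1_sig phi l' (z, _)); exact: dhom_ext.
Defined.

Section Currying.
Variables (Z W K : sSet).

Definition evS k (z : Z k) (phi : expS Z K k) : K k := proj1_sig phi k (z, did k).

Lemma evS_act k l (f : dhom l k) z phi :
  evS (act f z) (act f phi) = act f (evS z phi).
Proof.
by rewrite /evS -(proj2_sig phi) /=; congr (proj1_sig phi l (_, _)).
Qed.

Lemma evS_ext k (phi psi : expS Z K k) :
  (forall l (theta : dhom l k) z, evS z (act theta phi) = evS z (act theta psi)) ->
  phi = psi.
Proof.
move=> E; apply: exp_ext => l z theta; have := E l theta z.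
have d1 : dcomp theta (did l) = theta by exact: dhom_ext.
by rewrite /evS /= d1.
Qed.

Lemma curry_fun_nat (h : @hom sSet (prodS Z W) K) k (w : W k) :
  forall l m (f : dhom m l) (z : Z l) (theta : dhom l k),
  h m (act f z, act (dcomp theta f) w) = act f (h l (z, act theta w)).
Proof. by move=> l m f z theta; rewrite -hom_act -actM. Qed.

Definition curry_fun (h : @hom sSet (prodS Z W) K) k (w : W k) : expS Z K k :=
  exist _ (fun l x => h l (x.1, act x.2 w)) (curry_fun_nat h w).

Lemma curry_act (h : @hom sSet (prodS Z W) K) k l (f : dhom l k) (w : W k) :
  curry_fun h (act f w) = act f (curry_fun h w).
Proof. by apply: exp_ext => m z theta /=; rewrite actM. Qed.

Definition curryS (h : @hom sSet (prodS Z W) K) : @hom sSet W (expS Z K) :=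
  mkS (X := W) (Y := expS Z K) (curry_act h).

Lemma evS_curry h k (z : Z k) (w : W k) : evS z (curryS h k w) = h k (z, w).
Proof. by rewrite /evS /= act1. Qed.

End Currying.

(** By adjunction a horn in K^Z is a partial map defined on the product of Z with a horn. *)
Lemma Kan_exp Z K : Kan K -> Kan (expS Z K).
Proof.
move=> kK n k s.
pose G : srel (prodS Z (simplex n.+1)) K := fun l x y =>
  exists2 w : horn k l, x.2 = horn_incl k l w & y = evS x.1 (s l w).
have Gp : pmap G.
  split=> [l m f [z a] _ [w /= -> ->]|l [z a] _ _ [w /= -> ->] [w' /= e ->]].
    by exists (act f w) => //; rewrite hom_act evS_act.
  by congr (evS z (s l _)); case: w w' e => [w p] [w' p'] /= e; exact: eq_exist.
have Gd : defined_on G (fun l x => in_horn k x.2).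
  by move=> l [z a] ka; exists (evS z (s l (exist _ a ka))), (exist _ a ka).
have [h hP] := ext_hom (@hornZ_ext K Z n k kK) Gp Gd.
exists (curryS h); apply: natT_ext => l; apply: funext => w.
apply: evS_ext => m theta z; rewrite -!hom_act evS_curry /=.
apply: hP => /=; first exact: in_horn_comp (proj2_sig w).
by exists (act theta w).
Qed.

(** * Weakly equivalent inclusions *)

Lemma pmap_union (V K : sSet) (G1 G2 : srel V K) : pmap G1 -> pmap G2 ->
  (forall k x y y', G1 k x y -> G2 k x y' -> y = y') ->
  pmap (fun k x y => G1 k x y \/ G2 k x y).
Proof.
move=> [s1 f1] [s2 f2] c; split=> [k l f x y [/s1|/s2]|k x y y'].
- by left.
- by right.
- move=> [g|g] [g'|g']; [exact: f1 g g'|exact: c g g'| |exact: f2 g g'].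
  exact/esym/(c _ _ _ _ g' g).
Qed.

Lemma pmap_restr (V K : sSet) (S : sub V) (G : srel V K) : sclosed S -> pmap G ->
  pmap (fun k x y => S k x /\ G k x y).
Proof.
move=> Sc [s f]; split=> [k l g x y [Sx Gx]|k x y y' [_ g] [_]]; last exact: f.
by split; [exact: Sc|exact: s].
Qed.

Lemma at_end_nat (V K : sSet) (i : 'I_2) (H : @hom sSet (prodS V (simplex 1)) K)
  k l (f : dhom l k) (v : V k) :
  H l (act f v, dconst l i) = act f (H k (v, dconst k i)).
Proof. exact: (hom_act H f (v, dconst k i)). Qed.

Definition at_end (V K : sSet) (i : 'I_2) (H : @hom sSet (prodS V (simplex 1)) K) :
  @hom sSet V K := mkS (X := V) (at_end_nat i H).

Lemma dconst01 k : @dconst k 1 ord0 <> @dconst k 1 ord_max.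
Proof. by move=> /(congr1 (fun t : dhom k 1 => nat_of_ord (t ord0))). Qed.

Lemma end_closed V (i : 'I_2) :
  @sclosed (prodS V (simplex 1)) (fun k x => x.2 = dconst k i).
Proof. by move=> k l f [v t] /= ->; exact: act_dconst. Qed.

Lemma ends_closed V : @sclosed (prodS V (simplex 1))
  (fun k x => x.2 = dconst k ord0 \/ x.2 = dconst k ord_max).
Proof. by move=> k l f x [e|e]; [left|right]; exact: end_closed e. Qed.

Definition fstS (X Y : sSet) : @hom sSet (prodS X Y) X :=
  mkS (X := prodS X Y) (Y := X) (h := fun k x => x.1) (fun k l f x => erefl).
Definition sndS (X Y : sSet) : @hom sSet (prodS X Y) Y :=
  mkS (X := prodS X Y) (Y := Y) (h := fun k x => x.2) (fun k l f x => erefl).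

Section KanHomotopies.
Variables (K : sSet) (kK : Kan K).

(* The third side of a square whose other sides are [H1], [H2] and a constant
   homotopy. *)
Lemma homotopy_euclid X (H1 H2 : @hom sSet (prodS X (simplex 1)) K) :
  (forall k x, H1 k (x, dconst k ord0) = H2 k (x, dconst k ord0)) ->
  exists H : @hom sSet (prodS X (simplex 1)) K, forall k x,
    H k (x, dconst k ord0) = H1 k (x, dconst k ord_max) /\
    H k (x, dconst k ord_max) = H2 k (x, dconst k ord_max).
Proof.
move=> H12; pose V := prodS X (simplex 1).
pose G : srel (prodS V (simplex 1)) K := fun k x y =>
  (x.1.2 = dconst k ord0 /\ y = H1 k (x.1.1, x.2)) \/
  ((x.1.2 = dconst k ord_max /\ y = H2 k (x.1.1, x.2)) \/
   (x.2 = dconst k ord0 /\ y = H1 k (x.1.1, dconst k ord0))).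
have cl i : sclosed (fun k (x : prodS V (simplex 1) k) => x.1.2 = dconst k i).
  by move=> k l f [[x s] t] /= ->; exact: act_dconst.
pose R : @hom sSet (prodS V (simplex 1)) V :=
  mkS (X := prodS V (simplex 1)) (Y := V) (h := fun k x => (x.1.1, x.2)) (fun k l f x => erefl).
have Gp : pmap G.
  apply: pmap_union; first exact: (pmap_restr (cl ord0) (graph_pmap (mcomp H1 R))).
    apply: pmap_union; first exact: (pmap_restr (cl ord_max) (graph_pmap (mcomp H2 R))).
      exact: (pmap_restr (@end_closed V ord0) (graph_pmap
        (mcomp (at_end ord0 H1) (mcomp (@fstS _ _) (@fstS V (simplex 1)))))).
    by move=> k [[x s] t] _ _ /= [_ ->] [-> ->]; rewrite H12.
  move=> k [[x s] t] y y' /= [-> ->] [[e _]|[-> ->] //]; by case: (dconst01 e).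
have [|H HP] := ext_hom (Kan_hep0 kK (@ends_closed X)) Gp; last first.
  exists (at_end ord_max H) => k x; split.
  - by apply: HP => /=; left; [left|].
  - by apply: HP => /=; [left; right|right; left].
move=> k [[x s] t] /= [[->|->]|->].
- by exists (H1 k (x, t)); left.
- by exists (H2 k (x, t)); right; left.
- by exists (H1 k (x, dconst k ord0)); right; right.
Qed.

Lemma homotopy_refl X (f : @hom sSet X K) : homotopy f f.
Proof. by exists (mcomp f (@fstS X (simplex 1))). Qed.

(** A reflexive Euclidean relation is an equivalence relation, so a zigzag of homotopies into a Kan
    complex collapses to one homotopy. *)
Lemma homotopic_homotopy X (f g : @hom sSet X K) : homotopic f g -> homotopy f g.
Proof.
have E (a b c : @hom sSet X K) : homotopy a b -> homotopy a c -> homotopy b c.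
  move=> [H1 P1] [H2 P2]; have [|H HP] := @homotopy_euclid X H1 H2.
    by move=> k x; rewrite (P1 k x).1 (P2 k x).1.
  by exists H => k x; rewrite (HP k x).1 (HP k x).2 (P1 k x).2 (P2 k x).2.
have S (a b : @hom sSet X K) : homotopy a b -> homotopy b a.
  by move=> ab; exact: E ab (homotopy_refl a).
elim=> {f g} [f g //|f|f g _ /S //|f g h _ fg _]; first exact: homotopy_refl.
by move=> gh; exact: E (S _ _ fg) gh.
Qed.

End KanHomotopies.

Lemma homotopy_precomp X Y Z (f g : @hom sSet Y Z) (u : @hom sSet X Y) :
  homotopy f g -> homotopy (mcomp f u) (mcomp g u).
Proof.
move=> [H HP].
pose U : @hom sSet (prodS X (simplex 1)) (prodS Y (simplex 1)) :=
  mkS (X := prodS X (simplex 1)) (Y := prodS Y (simplex 1))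
   (h := fun k x => (u k x.1, x.2))
   (fun k l f x => congr1 (fun z => (z, dcomp x.2 f)) (hom_act u f x.1)).
by exists (mcomp H U) => k x; exact: HP.
Qed.

Lemma homotopic_precomp X Y Z (f g : @hom sSet Y Z) (u : @hom sSet X Y) :
  homotopic f g -> homotopic (mcomp f u) (mcomp g u).
Proof.
elim=> [a b ab|a|a b _ ab|a b c _ ab _ bc].
- by apply: rst_step; exact: homotopy_precomp.
- exact: rst_refl.
- exact: rst_sym.
- exact: rst_trans ab bc.
Qed.

Lemma homotopy_postcomp X Y Z (f g : @hom sSet X Y) (u : @hom sSet Y Z) :
  homotopy f g -> homotopy (mcomp u f) (mcomp u g).
Proof.
move=> [H HP]; exists (mcomp u H) => k x.
by split; congr (u k _); have [] := HP k x.
Qed.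

(* Simplices of the function complex Z -> K classified by a partial map on
   Z x D. *)
Definition classify (Z D K : sSet) (G : srel (prodS Z D) K) : srel D (expS Z K) :=
  fun k d phi => forall l (theta : dhom l k) z,
    G l (z, act theta d) (evS z (act theta phi)).

Lemma classify_pmap Z D K (G : srel (prodS Z D) K) : pmap G -> pmap (classify G).
Proof.
move=> [Gs Gf]; split=> [k l f d phi c m theta z|k d phi psi c c'].
  by rewrite !actM; exact: c.
by apply: evS_ext => l theta z; apply: Gf; [exact: c|exact: c'].
Qed.

Lemma classify_ex Z D K (G : srel (prodS Z D) K) k (d : D k) : pmap G ->
  (forall l (theta : dhom l k) z, exists y, G l (z, act theta d) y) ->
  exists phi, classify G d phi.
Proof.
move=> [Gs Gf] ex.
pose phi l (x : Z l * dhom l k) : K l := projT1 (cid (ex l x.2 x.1)).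
have phiP l x : G l (x.1, act x.2 d) (phi l x) by rewrite /phi; case: cid.
have phin l m (f : dhom m l) z theta :
    phi m (act f z, dcomp theta f) = act f (phi l (z, theta)).
  apply: (Gf _ _ _ _ (phiP _ _)) => /=; rewrite -actM.
  exact: (Gs _ _ f _ _ (phiP l (z, theta))).
exists (exist _ phi phin) => l theta z.
have d1 : dcomp theta (did l) = theta by exact: dhom_ext.
by rewrite /evS /= d1; exact: (phiP l (z, theta)).
Qed.

Lemma classify1 Z D K (G : srel (prodS Z D) K) k (d : D k) phi z :
  classify G d phi -> G k (z, d) (evS z phi).
Proof. by move=> /(_ _ (did k) z); rewrite !act1. Qed.

Section WeakEquivInclusion.
Variables (X V : sSet) (j : @hom sSet X V).
Hypotheses (jinj : forall k, injective (j k)) (wj : weak_equiv j).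

Definition im_sub (X V : sSet) (j : @hom sSet X V) : sub V :=
  fun k v => exists x, v = j k x.

Lemma im_closed (X' V' : sSet) (j' : @hom sSet X' V') : sclosed (im_sub j').
Proof. by move=> k l f _ [x ->]; exists (act f x); rewrite hom_act. Qed.

Variables (K : sSet) (kK : Kan K).

Definition swapS (A B : sSet) : @hom sSet (prodS A B) (prodS B A) :=
  mkS (X := prodS A B) (Y := prodS B A) (h := fun k x => (x.2, x.1))
    (fun k l f x => erefl).

(** Surjectivity for K^D extends g up to a homotopy; extending that homotopy from X x D to V x D
    makes the solution strict. *)
Lemma we_extend D (g : @hom sSet (prodS X D) K) :
  exists h : @hom sSet (prodS V D) K, forall k x d, h k (j k x, d) = g k (x, d).
Proof.
have [_ /(_ (curryS (mcomp g (@swapS D X))))] := wj (@Kan_exp D K kK).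
move=> [h0 /(homotopic_homotopy (@Kan_exp D K kK)) [T TP]].
pose W := prodS V D.
pose G : srel (prodS W (simplex 1)) K := fun k w y =>
  (exists2 x, w.1.1 = j k x & y = evS w.1.2 (T k (x, w.2))) \/
  (w.2 = dconst k ord0 /\ y = evS w.1.2 (h0 k w.1.1)).
have Gp : pmap G.
  apply: pmap_union.
  - split=> [k l f [[v d] t] _ [x /= -> ->]|k [[v d] t] _ _ [x /= -> ->] [x' /= /jinj -> ->]] //.
    by exists (act f x); rewrite ?hom_act // -evS_act -hom_act.
  - apply: (pmap_restr (@end_closed W ord0)).
    split=> [k l f [[v d] t] _ /= ->|k w _ _ -> -> //].
    by rewrite hom_act evS_act.
  - move=> k [[v d] t] _ _ /= [x -> ->] [-> ->].
    by rewrite (TP k x).1.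
have Uc : @sclosed W (fun k w => im_sub j w.1).
  by move=> k l f [v d]; exact: im_closed.
have [|H HP] := ext_hom (Kan_hep0 kK Uc) Gp; last first.
  exists (at_end ord_max H) => k x d; apply: HP; first by left; exists x.
  by left; exists x => //=; rewrite (TP k x).2 evS_curry.
move=> k [[v d] t] /= [[x ->]|->].
- by exists (evS d (T k (x, t))); left; exists x.
- by exists (evS d (h0 k v)); right.
Qed.

(** Injectivity for K^D. The homotopy obtained need not be constant on X x D; this is repaired in
    [universal_extension]. *)
Lemma we_homotopy D (u v : @hom sSet (prodS V D) K) :
  (forall k x d, u k (j k x, d) = v k (j k x, d)) -> homotopy u v.
Proof.
move=> uv; pose cur (w : @hom sSet (prodS V D) K) := curryS (mcomp w (@swapS D V)).
have [/(_ (cur u) (cur v)) + _] := wj (@Kan_exp D K kK).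
have -> : mcomp (cur u) j = mcomp (cur v) j.
  apply: natT_ext => k; apply: funext => x; apply: evS_ext => l theta d.
  have cE w (y : X l) : evS d (mcomp (cur w) j l y) = w l (j l y, d) by exact: evS_curry.
  by rewrite -!hom_act !cE.
move=> /(_ (rst_refl _ _ _))/(homotopic_homotopy (@Kan_exp D K kK)) [T TP].
have Hn k l (f : dhom l k) (x : prodS (prodS V D) (simplex 1) k) :
    evS (act f x).1.2 (T l ((act f x).1.1, (act f x).2)) =
    act f (evS x.1.2 (T k (x.1.1, x.2))).
  by rewrite -evS_act -hom_act.
exists (mkS (X := prodS (prodS V D) (simplex 1)) Hn) => k [x d] /=.
by rewrite (TP k x).1 (TP k x).2 !evS_curry.
Qed.

Let E := expS V K.
Let F := expS X K.

Lemma restr_nat k l (f : dhom l k) (x : prodS X E k) :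
  evS (j l (act f x).1) (act f x).2 = act f (evS (j k x.1) x.2).
Proof. by rewrite -evS_act -hom_act. Qed.

Let p : @hom sSet E F := curryS (mkS (X := prodS X E) restr_nat).

Let pE k x phi : evS x (p k phi) = evS (j k x) phi.
Proof. by rewrite evS_curry. Qed.

(* [q] extends maps from X to V naturally in the parameters, so the loop of
   X-components of a homotopy from [q \o p] to the identity can be extended to V
   by [q] itself and cancelled; the resulting homotopy is constant on X. *)
Lemma universal_extension : exists (q : @hom sSet (prodS V F) K)
  (W : @hom sSet (prodS (prodS V E) (simplex 1)) K),
  [/\ forall k x phi, q k (j k x, phi) = evS x phi,
      forall k v e, W k ((v, e), dconst k ord0) = q k (v, p k e),
      forall k v e, W k ((v, e), dconst k ord_max) = evS v e &
      forall k x e s, W k ((j k x, e), s) = evS (j k x) e].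
Proof.
have ev_nat k l (f : dhom l k) (x : prodS X F k) :
  evS (act f x).1 (act f x).2 = act f (evS x.1 x.2) by rewrite -evS_act.
have [q qE] := we_extend (mkS (X := prodS X F) ev_nat).
have evV_nat k l (f : dhom l k) (x : prodS V E k) :
  evS (act f x).1 (act f x).2 = act f (evS x.1 x.2) by rewrite -evS_act.
have qp_nat k l (f : dhom l k) (x : prodS V E k) :
    q l ((act f x).1, p l (act f x).2) = act f (q k (x.1, p k x.2)).
  have -> : p l (act f x).2 = act f (p k x.2) by exact: (hom_act p f x.2).
  exact: (hom_act q f (x.1, p k x.2)).
have [|H HP] := @we_homotopy E (mkS (X := prodS V E) qp_nat) (mkS (X := prodS V E) evV_nat).
  by move=> k x d; exact: etrans (qE _ _ _) (pE x d).
have {}qE k x phi : q k (j k x, phi) = evS x phi by exact: qE.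
have H0 k v e : H k ((v, e), dconst k ord0) = q k (v, p k e) by exact: (HP k (v, e)).1.
have H1 k v e : H k ((v, e), dconst k ord_max) = evS v e by exact: (HP k (v, e)).2.
have pH_nat k l (f : dhom l k) (x : prodS X (prodS E (simplex 1)) k) :
    H l ((j l (act f x).1, (act f x).2.1), (act f x).2.2) =
    act f (H k ((j k x.1, x.2.1), x.2.2)).
  by rewrite (hom_act j); exact: (hom_act H f ((j k x.1, x.2.1), x.2.2)).
pose pH : @hom sSet (prodS E (simplex 1)) F :=
  curryS (mkS (X := prodS X (prodS E (simplex 1))) pH_nat).
have pHE k x e t : evS x (pH k (e, t)) = H k ((j k x, e), t) by rewrite evS_curry.
have pH0 k e : pH k (e, dconst k ord0) = p k e.
  apply: evS_ext => l theta x; rewrite -!hom_act pHE pE.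
  by rewrite H0 qE pE.
have pH1 k e : pH k (e, dconst k ord_max) = p k e.
  apply: evS_ext => l theta x; rewrite -!hom_act pHE pE.
  by rewrite H1.
pose B := prodS (prodS V E) (simplex 1).
(* A square with s the direction of [W] and t the direction of extension: the side s = 0 is [q]
   applied to the loop, the side s = 1 and the part over X are [H], and t = 0 is constant in s. At t
   = 1 the part over X has become constant in s, which is what [W] needs. *)
pose G : srel (prodS B (simplex 1)) K := fun k x y =>
  (x.1.2 = dconst k ord0 /\ y = q k (x.1.1.1, pH k (x.1.1.2, x.2))) \/
  ((x.1.2 = dconst k ord_max /\ y = H k (x.1.1, x.2)) \/
   ((im_sub j x.1.1.1 /\ y = H k (x.1.1, x.2)) \/
    (x.2 = dconst k ord0 /\ y = q k (x.1.1.1, p k x.1.1.2)))).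
have cl i : sclosed (fun k (x : prodS B (simplex 1) k) => x.1.2 = dconst k i).
  by move=> k l f [[x s] t] /= ->; exact: act_dconst.
have clX : sclosed (fun k (x : prodS B (simplex 1) k) => im_sub j x.1.1.1).
  by move=> k l f [[[v e] s] t]; exact: im_closed.
have g1 : pmap (fun k (x : prodS B (simplex 1) k) y =>
    y = q k (x.1.1.1, pH k (x.1.1.2, x.2))).
  split=> [k l f x _ ->|k x _ _ -> -> //].
  rewrite -(hom_act q f (x.1.1.1, pH k (x.1.1.2, x.2))).
  exact: (congr1 (fun e => q l (act f x.1.1.1, e)) (esym (hom_act pH f (x.1.1.2, x.2)))).
have g2 : pmap (fun k (x : prodS B (simplex 1) k) y => y = H k (x.1.1, x.2)).
  split=> [k l f x _ ->|k x _ _ -> -> //].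
  exact: (esym (hom_act H f (x.1.1, x.2))).
have g3 : pmap (fun k (x : prodS B (simplex 1) k) y => y = q k (x.1.1.1, p k x.1.1.2)).
  split=> [k l f x _ ->|k x _ _ -> -> //].
  rewrite -(hom_act q f (x.1.1.1, p k x.1.1.2)).
  exact: (congr1 (fun e => q l (act f x.1.1.1, e)) (esym (hom_act p f x.1.1.2))).
have Gp : pmap G.
  apply: pmap_union; [exact: (pmap_restr (cl ord0) g1)|apply: pmap_union|].
  - exact: (pmap_restr (cl ord_max) g2).
  - apply: pmap_union; [exact: (pmap_restr clX g2)|exact: (pmap_restr (@end_closed B ord0) g3)|].
    move=> k [[[v e] s] t] _ _ /= [[x ->] ->] [-> ->].
    by rewrite H0.
  - move=> k [[[v e] s] t] _ _ /= [_ ->] [[_ ->]|[-> ->]]; first by [].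
    by rewrite H0.
  - move=> k [[[v e] s] t] y y' /= [-> ->] [[e0 _]|[[[x ->] ->]|[-> ->]]].
      by case: (dconst01 e0).
      by rewrite qE pHE.
    exact: (congr1 (fun z => q k (v, z)) (pH0 k e)).
have Uc : @sclosed B (fun k x => (x.2 = dconst k ord0 \/ x.2 = dconst k ord_max) \/
    im_sub j x.1.1).
  move=> k l f [[v e] s] [es|ix]; [left|right]; first exact: (@ends_closed (prodS V E) k l f ((v, e), s) es).
  exact: im_closed.
have [|W WP] := ext_hom (Kan_hep0 kK Uc) Gp; last first.
  exists q, (at_end ord_max W); split.
  - by move=> k x phi; rewrite qE.
  - move=> k v e; apply: WP; first by left; left; left.
    by left; split=> //; rewrite pH1.
  - move=> k v e; apply: WP; first by left; left; right.
    by right; left; split=> //; rewrite H1.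
  - move=> k x e s; apply: WP; first by left; right; exists x.
    right; right; left; split; first by exists x.
    by rewrite H1.
move=> k [[[v e] s] t] /= [[[->|->]|ix]|->]; eexists.
- by left.
- by right; left.
- by right; right; left.
- by right; right; right.
Qed.

(** Let [b] classify the given map on X x D. Then q(v, b d) is an extension with the right values on
    X, and [W] deforms it over C to the given one. As [W] is constant on X, the data on X x D and V
    x C are compatible, and homotopy extension finishes. *)
Lemma we_ext D (C : sub D) : sclosed C ->
  ext (fun k (x : prodS V D k) => im_sub j x.1 \/ C k x.2) (@sall (prodS V D)) K.
Proof.
move=> Cc G Gp Gd.
have [q [W [qE W0 W1 WX]]] := universal_extension.
have jn k l (f : dhom l k) (x : prodS X D k) :
    (j l (act f x).1, (act f x).2) = act f ((j k x.1, x.2) : prodS V D k).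
  by rewrite /= hom_act.
pose jD := mkS (X := prodS X D) (Y := prodS V D) jn.
have [b bP] : exists b : @hom sSet D F, forall k d,
    classify (fun k x y => G k (jD k x) y) d (b k d).
  apply: total_hom; first by apply: classify_pmap; exact: pull_pmap.
  move=> k d _; apply: classify_ex; first exact: pull_pmap.
  by move=> l theta x; apply: Gd; left; exists x.
have pb k d e : classify G d e -> p k e = b k d.
  move=> c; apply: ((classify_pmap (pull_pmap jD Gp)).2 _ _ _ _ _ (bP k d)).
  move=> l theta x; rewrite -hom_act pE /=; exact: c.
pose B := prodS V D.
pose H : srel (prodS B (simplex 1)) K := fun k x y =>
  (C k x.1.2 /\ exists2 e, classify G x.1.2 e & y = W k ((x.1.1, e), x.2)) \/
  ((im_sub j x.1.1 /\ G k x.1 y) \/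
   (x.2 = dconst k ord0 /\ y = q k (x.1.1, b k x.1.2))).
have Hp : pmap H.
  apply: pmap_union; last 1 first.
  - move=> k [[v d] s] _ y /= [_ [e c ->]] [[[x ->] Gy]|[-> ->]].
      by rewrite WX; exact: (Gp.2 _ _ _ _ (classify1 _ c) Gy).
    by rewrite W0 (pb _ _ _ c).
  - apply: (pmap_restr (S := fun k (x : prodS B (simplex 1) k) => C k x.1.2)).
      by move=> k l f [[v d] s]; exact: Cc.
    split=> [k l f [[v d] s] _ /= [e c ->]|k [[v d] s] _ _ /= [e c ->] [e' c' ->]].
      exists (@act (expS V K) k l f e); first exact: (classify_pmap Gp).1.
      exact: (esym (hom_act W f ((v, e), s))).
    by rewrite ((classify_pmap Gp).2 _ _ _ _ c c').
  - apply: pmap_union.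
    + apply: (pmap_restr (S := fun k (x : prodS B (simplex 1) k) => im_sub j x.1.1)).
        by move=> k l f [[v d] s]; exact: im_closed.
      exact: (pull_pmap (@fstS B (simplex 1)) Gp).
    + apply: (pmap_restr (@end_closed B ord0)).
      split=> [k l f x _ ->|k x _ _ -> -> //].
      rewrite -(hom_act q f (x.1.1, b k x.1.2)).
      exact: (congr1 (fun z => q l (act f x.1.1, z)) (esym (hom_act b f x.1.2))).
    + move=> k [[v d] s] y _ /= [[x ->] Gy] [_ ->].
      by rewrite qE; apply: (Gp.2 _ _ _ _ Gy); exact: (classify1 x (bP k d)).
have Uc : @sclosed B (fun k x => im_sub j x.1 \/ C k x.2).
  by move=> k l f [v d] [iv|Cd]; [left; exact: im_closed|right; exact: Cc].
have cex k d : C k d -> exists e, classify G d e.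
  move=> Cd; apply: classify_ex => // l theta v; apply: Gd; right; exact: Cc.
have [|R RP] := ext_hom (Kan_hep0 kK Uc) Hp; last first.
  exists (graph (at_end ord_max R)); split; first exact: graph_pmap.
    by move=> k x _; exists (at_end ord_max R k x).
  move=> k [v d] y /= Bx Gy; apply/esym/RP; first by left.
  case: Bx => [iv|Cd]; first by right; left.
  have [e c] := cex _ _ Cd; left; split=> //; exists e => //=.
  by rewrite W1; exact: (Gp.2 _ _ _ _ Gy (classify1 v c)).
move=> k [[v d] s] /= [[iv|Cd]|->].
- have [|y Gy] := Gd k (v, d); first by left.
  by exists y; right; left.
- have [e c] := cex _ _ Cd.
  by exists (W k ((v, e), s)); left; split=> //; exists e.
- by exists (q k (v, b k d)); right; right.
Qed.

End WeakEquivInclusion.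

(** * Acyclic inclusions *)

(* For closed A < B, this says that K^B -> K^A is a trivial fibration for all Kan
   complexes K. *)
Definition acyc (V : sSet) (A B : sub V) := forall K, Kan K ->
  forall D (C : sub D), sclosed C ->
  ext (fun k (x : prodS V D k) => B k x.1 /\ (A k x.1 \/ C k x.2))
      (fun k (x : prodS V D k) => B k x.1) K.

Lemma ext_iff V (A A' B B' : sub V) K : (forall k x, A k x <-> A' k x) ->
  (forall k x, B' k x -> B k x) -> ext A B K -> ext A' B' K.
Proof.
move=> AA BB E G Gp Gd; have [|G' [p' d' e']] := E G Gp.
  by move=> k x /AA; exact: Gd.
exists G'; split=> // [k x /BB|k x y /AA]; [exact: d'|exact: e'].
Qed.

Lemma acyc_iff V (A A' B B' : sub V) : (forall k x, A k x <-> A' k x) ->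
  (forall k x, B k x <-> B' k x) -> acyc A B -> acyc A' B'.
Proof.
move=> AA BB E K kK D C Cc; apply: ext_iff (E K kK D C Cc) => k x; last by move/BB.
by split=> -[/BB ? [/AA ?|?]]; split=> //; [left|right|left|right].
Qed.

Lemma we_acyc X V (j : @hom sSet X V) : (forall k, injective (j k)) ->
  weak_equiv j -> acyc (im_sub j) (@sall V).
Proof.
move=> ji wj K kK D C Cc; apply: ext_iff (we_ext ji wj kK Cc) => // k x.
by split=> [|[]].
Qed.

Lemma acyc_glue V (A B : sub V) : sclosed A -> sclosed B ->
  acyc (fun k x => A k x /\ B k x) B -> acyc A (fun k x => A k x \/ B k x).
Proof.
move=> Ac Bc E K kK D C Cc G Gp Gd.
have [|G' [p' d' e']] := E K kK D C Cc G Gp.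
  move=> k x [Bx ABC]; apply: Gd; split; first by right.
  by case: ABC => [[]|]; [left|right].
exists (fun k x y => (A k x.1 /\ G k x y) \/ (B k x.1 /\ G' k x y)); split.
- apply: pmap_union.
  + by apply: (pmap_restr _ Gp) => k l f x; exact: Ac.
  + by apply: (pmap_restr _ p') => k l f x; exact: Bc.
  + move=> k x y y' [Ax Gy] [Bx Gy']; apply: (p'.2 _ _ _ _ _ Gy').
    by apply: e' => //; split=> //; left.
- move=> k x [Ax|Bx]; last by have [y] := d' _ _ Bx; exists y; right.
  have [|y] := Gd k x; first by split; left.
  by exists y; left.
- move=> k x y [AB ac] Gy; case: (pselect (A k x.1)) => Ax; first by left.
  right; case: AB => // Bx; split=> //; apply: e' => //; split=> //.
  by case: ac => //; right.
Qed.

(** Extending from [A] and C gives [h], which may differ from [G] on [B]. The two agree on [A] and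
    over C, so acyclicity of [A] in [B], applied to D x Delta[1] with its ends, joins them by a
    homotopy [T] over [B]. Extending [T] to V x D moves [h] to a map that agrees with [G] on [B]. *)
Lemma acyc_cancel V (A B : sub V) : sclosed A -> sclosed B ->
  (forall k x, A k x -> B k x) -> acyc A B -> acyc A (@sall V) -> acyc B (@sall V).
Proof.
move=> Ac Bc AB EAB EA K kK D C Cc G Gp Gd.
have [||h hG] := ext_hom (A := fun k (x : prodS V D k) => A k x.1 \/ C k x.2) _ Gp.
- by apply: ext_iff (EA K kK D C Cc) => // k x; split=> [[]|].
- by move=> k x ac; apply: Gd; split=> //; case: ac => [/AB|]; [left|right].
pose D' := prodS D (simplex 1).
pose C' : sub D' := fun k x =>
  C k x.1 \/ (x.2 = dconst k ord0 \/ x.2 = dconst k ord_max).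
have C'c : sclosed C'.
  move=> k l f [d t] [Cd|e]; [left; exact: Cc|right].
  exact: (@ends_closed D k l f (d, t) e).
pose R : @hom sSet (prodS V D') (prodS V D) :=
  mkS (X := prodS V D') (Y := prodS V D) (h := fun k x => (x.1, x.2.1))
    (fun k l f x => erefl).
pose G2 : srel (prodS V D') K := fun k x y =>
  ((A k x.1 \/ C k x.2.1) /\ G k (R k x) y) \/
  ((x.2.2 = dconst k ord0 /\ y = h k (R k x)) \/
   ((B k x.1 /\ x.2.2 = dconst k ord_max) /\ G k (R k x) y)).
have endc i : sclosed (fun k (x : prodS V D' k) => x.2.2 = dconst k i).
  by move=> k l f [v [d t]] /= ->; exact: act_dconst.
have AC_cl : sclosed (fun k (x : prodS V D k) => A k x.1 \/ C k x.2).
  by move=> k l f x [Ax|Cx]; [left; exact: Ac|right; exact: Cc].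
have G2p : pmap G2.
  apply: pmap_union; [|apply: pmap_union|].
  - apply: (pmap_restr (S := fun k (x : prodS V D' k) => A k x.1 \/ C k x.2.1)) (pull_pmap R Gp).
    by move=> k l f x; exact: (@AC_cl k l f (R k x)).
  - exact: (pmap_restr (endc ord0) (graph_pmap (mcomp h R))).
  - apply: (pmap_restr
      (S := fun k (x : prodS V D' k) => B k x.1 /\ x.2.2 = dconst k ord_max))
      (pull_pmap R Gp).
    by move=> k l f x [Bx e]; split; [exact: Bc|exact: endc e].
  - by move=> k [v [d t]] y y' /= [-> _] [[_ e] _]; case: (dconst01 e).
  - move=> k [v [d t]] y y' /= [ac Gy] [[_ ->]|[_ Gy']]; last exact: (Gp.2 _ _ _ _ Gy Gy').
    by rewrite (hG k (v, d) _ ac Gy).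
have G2d : defined_on G2 (fun k x => B k x.1 /\ (A k x.1 \/ C' k x.2)).
  have GAC k (x : prodS V D' k) : A k x.1 \/ C k x.2.1 -> exists y, G2 k x y.
    move=> ac; have [|y Gy] := Gd k (R k x).
      by split=> //; case: ac => [/AB|]; [left|right].
    by exists y; left.
  move=> k [v [d t]] /= [Bv [Av|[Cd|[/= ->|/= ->]]]].
  - by apply: GAC; left.
  - by apply: GAC; right.
  - by exists (h k (v, d)); right; left.
  - have [|y Gy] := Gd k (v, d); first by split=> //; left.
    by exists y; right; right.
have [T [Tp Td TG]] := EAB K kK D' C' C'c G2 G2p G2d.
pose W := prodS V D.
pose asc : @hom sSet (prodS W (simplex 1)) (prodS V D') :=
  mkS (X := prodS W (simplex 1)) (Y := prodS V D') (h := fun k x => (x.1.1, (x.1.2, x.2)))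
    (fun k l f x => erefl).
pose H : srel (prodS W (simplex 1)) K := fun k x y =>
  (B k x.1.1 /\ T k (asc k x) y) \/
  (((A k x.1.1 \/ C k x.1.2) /\ G k x.1 y) \/
   (x.2 = dconst k ord0 /\ y = h k x.1)).
have Hp : pmap H.
  apply: pmap_union; [|apply: pmap_union|].
  - apply: (pmap_restr (S := fun k (x : prodS W (simplex 1) k) => B k x.1.1)) (pull_pmap asc Tp).
    by move=> k l f x; exact: Bc.
  - apply: (pmap_restr (S := fun k (x : prodS W (simplex 1) k) => A k x.1.1 \/ C k x.1.2))
      (pull_pmap (@fstS W (simplex 1)) Gp).
    by move=> k l f x; exact: (@AC_cl k l f x.1).
  - exact: (pmap_restr (@end_closed W ord0) (graph_pmap (mcomp h (@fstS W (simplex 1))))).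
  - by move=> k [[v d] t] y y' /= [ac Gy] [_ ->]; rewrite (hG k (v, d) _ ac Gy).
  - move=> k [[v d] t] y y' /= [Bv Ty] [[ac Gy]|[tE ->]]; last rewrite {t}tE in Ty.
      apply: (Tp.2 _ _ _ _ Ty); apply: TG => /=; last by left.
      by split=> //; case: ac; [left|right; left].
    apply: (Tp.2 _ _ _ _ Ty); apply: TG => /=; last by right; left.
    by split=> //; right; right; left.
have Uc : @sclosed W (fun k x => B k x.1 \/ C k x.2).
  by move=> k l f x [Bx|Cx]; [left; exact: Bc|right; exact: Cc].
have [|F FP] := ext_hom (Kan_hep0 kK Uc) Hp.
  move=> k [[v d] t] /= [[Bv|Cd]|->].
  - by have [y Ty] := Td k (v, (d, t)) Bv; exists y; left.
  - have [|y Gy] := Gd k (v, d); first by split=> //; right.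
    by exists y; right; left; split=> //; right.
  - by exists (h k (v, d)); right; right.
exists (graph (at_end ord_max F)); split; first exact: graph_pmap.
  by move=> k x _; exists (at_end ord_max F k x).
move=> k [v d] y /= [_ BC] Gy; apply/esym/FP; first by left.
case: BC => [Bv|Cd]; last by right; left; split=> //; right.
left; split=> //; apply: TG => /=; first by split=> //; right; right; right.
by right; right.
Qed.

Definition img_sub (V' V : sSet) (u : @hom sSet V' V) (S : sub V') : sub V :=
  fun k v => exists2 v', v = u k v' & S k v'.

Lemma acyc_img V' V (u : @hom sSet V' V) (A B : sub V') :
  (forall k, injective (u k)) -> acyc A B -> acyc (img_sub u A) (img_sub u B).
Proof.
move=> ui E K kK D C Cc G Gp Gd.
have un k l (f : dhom l k) (x : prodS V' D k) :
  (u l (act f x).1, (act f x).2) = act f ((u k x.1, x.2) : prodS V D k).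
  by rewrite /= hom_act.
have [|G' [p' d' e']] := E K kK D C Cc _ (pull_pmap (mkS (X := prodS V' D) (Y := prodS V D) un) Gp).
  move=> k [v d] /= [Bv ac]; apply: Gd; split; first by exists v.
  by case: ac => [Av|Cd]; [left; exists v|right].
exists (fun k x y => exists2 v', x.1 = u k v' & G' k (v', x.2) y); split; first split.
- move=> k l f [v d] y [v' /= -> Gy]; exists (act f v'); first by rewrite hom_act.
  exact: (p'.1 k l f (v', d) y Gy).
- by move=> k [v d] y y' [v' /= -> Gy] [v'' /= /ui <-]; exact: p'.2.
- by move=> k [v d] [v' /= -> Bv]; have [y] := d' k (v', d) Bv; exists y, v'.
- move=> k [v d] y /= [[v' -> Bv] ac] Gy; exists v' => //; apply: e' => //=; split=> //.
  by case: ac => [[v'' /ui <-]|Cd]; [left|right].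
Qed.

(** By associativity of the product, D and the test parameter D' merge into a single parameter. *)
Lemma acyc_box V (A : sub V) D (C : sub D) : sclosed C -> acyc A (@sall V) ->
  acyc (fun k (x : prodS V D k) => A k x.1 \/ C k x.2) (@sall (prodS V D)).
Proof.
move=> Cc E K kK D' C' C'c G Gp Gd.
pose asc : @hom sSet (prodS V (prodS D D')) (prodS (prodS V D) D') :=
  mkS (X := prodS V (prodS D D')) (Y := prodS (prodS V D) D')
   (h := fun k x => ((x.1, x.2.1), x.2.2)) (fun k l f x => erefl).
have CC : @sclosed (prodS D D') (fun k x => C k x.1 \/ C' k x.2).
  by move=> k l f x [Cx|Cx]; [left; exact: Cc|right; exact: C'c].
have [|G' [p' d' e']] := E K kK _ _ CC _ (pull_pmap asc Gp).
  move=> k [v [d d']] /= [_ [Av|[Cd|Cd]]]; apply: Gd; split=> //; [|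
    |by right]; left; [by left|by right].
exists (fun k x y => G' k (x.1.1, (x.1.2, x.2)) y); split; first split.
- by move=> k l f [[v d] e] y; exact: (p'.1 k l f (v, (d, e)) y).
- by move=> k x y y'; exact: p'.2.
- by move=> k x _; exact: d'.
- move=> k [[v d] e] y /= [_ ac] Gy; apply: e' => //=; split=> //.
  by case: ac => [[Av|Cd]|Ce]; [left|right; left|right; right].
Qed.

(** * Latching objects and diagonals of acyclic inclusions *)

Section DegeneracyFiltration.
Variables (Y : functor (opC Delta) sSet) (A : forall p, sub (Y p)).
Hypothesis Ah : forall p q (theta : dhom q p) k (z : Y p k), A z -> A (hact theta z).
Hypothesis Av : forall p, sclosed (@A p).
Hypothesis Aacyc : forall p, acyc (@A p) (@sall (Y p)).

Let hhom p q (theta : dhom q p) : @hom sSet (Y p) (Y q) :=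
  @fmap (opC Delta) sSet Y p q theta.

Let codegK p j k (w : Y p k) : j <= p ->
  hact (coface (inord j.+1)) (hact (codeg p j) w) = w.
Proof. by move=> jp; rewrite hactM codeg_cofaceK // hact1. Qed.

(* The simplices degenerate at some i < j + 1 are obtained from those degenerate
   at some i < j by adding the image of the j-th degeneracy, along a pushout. *)
Lemma degen_acyc p j : j <= p ->
  acyc (fun k (z : Y p k) => A z \/ degen j z) (@sall (Y p)).
Proof.
elim: p j => [|p IHp] j.
  rewrite leqn0 => /eqP ->; apply: acyc_iff (@Aacyc 0) => // k z.
  by split=> [|[//|[q [psi [w [a [b []]]]]]]]; [left|].
elim: j => [_|j IHj jp].
  apply: acyc_iff (@Aacyc p.+1) => // k z.
  by split=> [|[//|[q [psi [w [a [b []]]]]]]]; [left|].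
have cl i : sclosed (fun k (z : Y p.+1 k) => A z \/ degen i z).
  by move=> k l f z [Az|dz]; [left; exact: Av|right; exact: degen_act].
have degS k (z : Y p.+1 k) : degen j.+1 z <->
    degen j z \/ img_sub (hhom (codeg p j)) (@sall _) z.
  split=> [[q [psi [w [a [b [zE ba aj ab]]]]]]|[[q [psi [w [a [b [zE ba aj ab]]]]]]|[w zE _]]].
  - have [aj'|ja] := ltnP a j; first by left; exists q, psi, w, a, b.
    have {ja aj} ja : a = j :> nat by lia.
    right; exists (hact (dcomp psi (coface b)) w) => //.
    by rewrite -[RHS]/(hact _ _) hactM zE -ja -codeg_factor.
  - by exists q, psi, w, a, b; split=> //; lia.
  - have j1 : j < p.+2 by lia.
    exists p, (codeg p j), w, (Ordinal j1), (Ordinal (jp : j.+1 < p.+2)); split=> //.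
    by apply: ord_inj; rewrite !codegE /=; lia.
apply: (@acyc_cancel _ (fun k (z : Y p.+1 k) => A z \/ degen j z)) => //.
- by move=> k z [Az|dz]; [left|right; apply/degS; left].
- have := @acyc_glue _ _ (img_sub (hhom (codeg p j)) (@sall _)) (cl j).
  have imc : sclosed (img_sub (hhom (codeg p j)) (@sall _)).
    by move=> k l f _ [w -> _]; exists (act f w); rewrite ?hom_act.
  move=> /(_ imc) glue; apply: acyc_iff (glue _) => // [k z|].
    split=> [[[Az|dz]|iz]|[Az|/degS[dz|iz]]]; [by left| | |by left; left|by left; right|by right].
      by right; apply/degS; left.
    by right; apply/degS; right.
  (* The j-th degeneracy of w is in [A] or [degen j] exactly if w is, one degree lower. Indeed
     [codeg p j] and [coface (inord j.+1)] fix all vertices up to j, so they keep the pair a, a + 1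
     with a < j that witnesses degeneracy. *)
  apply: acyc_iff (acyc_img (u := hhom (codeg p j)) _ (IHp j jp)) => // [k z|]; last first.
    move=> k w w' e; rewrite -(codegK w (jp : j <= p)) -(codegK w' (jp : j <= p)).
    by congr (hact _ _).
  split=> [[w -> [Aw|[q [psi [w' [a [b [wE ba aj ab]]]]]]]]|[+ [w zE _]]].
  + by split; [left; exact: Ah|exists w].
  + split; last by exists w.
    right; exists q, (dcomp psi (codeg p j)), w', (inord a), (inord b).
    have ap := ltn_ord a; have bp := ltn_ord b.
    have aK : codeg p j (inord a) = a.
      by apply: ord_inj; rewrite codegE inordK; lia.
    have bK : codeg p j (inord b) = b.
      by apply: ord_inj; rewrite codegE inordK; lia.
    split; [by rewrite -hactM -wE|by rewrite !inordK; lia|by rewrite inordK; lia|].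
    by rewrite !dcompE aK bK.
  + move=> zP; exists w => //; rewrite -(codegK w (jp : j <= p)) -[hact (codeg p j) w]zE.
    case: zP => [Az|[q [psi [w' [a [b [zE' ba aj ab]]]]]]]; first by left; exact: Ah.
    right; exists q, (dcomp psi (coface (inord j.+1))), w', (inord a), (inord b).
    have aK : coface (inord j.+1) (inord a : 'I_p.+1) = a.
      by apply: ord_inj; rewrite cofaceE !inordK; lia.
    have bK : coface (inord j.+1) (inord b : 'I_p.+1) = b.
      by apply: ord_inj; rewrite cofaceE !inordK; lia.
    split; [by rewrite zE' hactM|by rewrite !inordK; lia|by rewrite inordK; lia|].
    by rewrite !dcompE aK bK.
- by apply: IHj; exact: ltnW.
Qed.

End DegeneracyFiltration.

Section DiagonalAcyclic.
Variables (Y : functor (opC Delta) sSet) (A : forall p, sub (Y p)).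
Hypothesis Ah : forall p q (theta : dhom q p) k (z : Y p k), A z -> A (hact theta z).
Hypothesis Av : forall p, sclosed (@A p).
Hypothesis Aacyc : forall p, acyc (@A p) (@sall (Y p)).

Section ConstantFactor.
Variables (D : sSet) (C : sub D).
Hypothesis Cc : sclosed C.

Lemma par_nat p q (theta : dhom q p) k l (f : dhom l k) (x : prodS (Y p) D k) :
  (hact theta (act f x).1, (act f x).2) =
  act f ((hact theta x.1, x.2) : prodS (Y q) D k).
Proof. by rewrite /= hact_act. Qed.

Definition parB : functor (opC Delta) sSet.
Proof.
refine (@Functor (opC Delta) sSet (fun p => prodS (Y p) D)
  (fun p q theta => @mkS (prodS (Y p) D) (prodS (Y q) D) _ (par_nat theta)) _ _).
- by move=> p; apply: natT_ext => k; apply: funext => -[z d] /=; rewrite hact1.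
- by move=> p q r g f; apply: natT_ext => k; apply: funext => -[z d] /=; rewrite hactM.
Defined.

(** The test parameter D is absorbed into the simplicial space as a factor constant in p. What is
    left to check on cells is then acyclicity of the latching inclusion against the boundary of
    Delta[p]. *)
Lemma par_ext K : Kan K ->
  ext (fun k (x : prodS (diag Y) D k) => A (x.1 : Y k k) \/ C x.2) (@sall (prodS (diag Y) D)) K.
Proof.
move=> kK.
have hA p q (theta : dhom q p) k (z : parB p k) :
    A z.1 \/ C z.2 -> A (hact theta z).1 \/ C (hact theta z).2.
  by case=> [Az|Cz]; [left; exact: Ah|right].
have vA p : @sclosed (parB p) (fun k z => A z.1 \/ C z.2).
  by move=> k l f z [Az|Cz]; [left; exact: Av|right; exact: Cc].
apply: (@skel_ext parB K (fun p k z => A z.1 \/ C z.2)) => // p.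
have := degen_acyc hA vA (fun p => acyc_box Cc (@Aacyc p)) (leqnn p).
have bc : sclosed (fun k (a : simplex p k) => bdry a) by move=> k l f a; exact: bdry_comp.
move=> /(_ K kK _ _ bc) E; apply: ext_iff E => // k x.
by split=> [[]|].
Qed.

End ConstantFactor.

Lemma diag_acyc : acyc (fun k (y : diag Y k) => A (y : Y k k)) (@sall (diag Y)).
Proof.
move=> K kK D C Cc; apply: ext_iff (par_ext Cc kK) => // k x.
by split=> [|[]].
Qed.

End DiagonalAcyclic.

(** * Mapping cylinders, diagonals and products *)

Section MappingCylinder.
Variables (X Y : sSet) (f : @hom sSet X Y).

(* A simplex (t, y, o) of the mapping cylinder (X x D^1) u_X Y over t in D^1:
   [o] is None over the vertex 1, and a lift of y to X otherwise. *)
Definition cylP k (x : dhom k 1 * (Y k * option (X k))) : Prop :=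
  (x.1 = dconst k ord_max /\ x.2.2 = None) \/
  (x.1 <> dconst k ord_max /\ exists2 x0, x.2.2 = Some x0 & x.2.1 = f k x0).

(** Pulling back can make t constant at 1, where the lift to X must be forgotten; so every operation
    on the cylinder ends with a [cut]. *)
Definition cut k (t : dhom k 1) (o : option (X k)) : option (X k) :=
  if pselect (t = dconst k ord_max) then None else o.

Lemma cut_id k t y (o : option (X k)) : cylP (t, (y, o)) -> cut t o = o.
Proof.
by rewrite /cut; case: pselect => // e [[_ /= ->] //|[]].
Qed.

Lemma cylP_cut k t y (o : option (X k)) t' :
  (t = dconst k ord_max -> t' = dconst k ord_max) ->
  cylP (t, (y, o)) -> cylP (t', (y, cut t' o)).
Proof.
move=> tt' [[/= /tt' -> _]|[_ /= [x ox yx]]]; rewrite /cut; case: pselect => // e.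
- by left.
- by left.
- by right; split=> //; exists x.
Qed.

Lemma cylP_act k l (g : dhom l k) t y o : cylP (t, (y, o)) ->
  cylP (dcomp t g, (act g y, cut (dcomp t g) (omap (act g) o))).
Proof.
case=> [[/= -> ->]|[_ [x /= -> ->]]]; rewrite /cut; case: pselect => e.
- by left.
- by case: e; exact: act_dconst.
- by left.
- by right; split=> //; exists (act g x); rewrite //= hom_act.
Qed.

Definition cyl_act k l (g : dhom l k)
  (x : {x : dhom k 1 * (Y k * option (X k)) | cylP x}) :
  {x : dhom l 1 * (Y l * option (X l)) | cylP x}.
Proof.
exists (dcomp (sval x).1 g, (act g (sval x).2.1,
  cut (dcomp (sval x).1 g) (omap (act g) (sval x).2.2))).
by case: x => -[t [y o]] /= /cylP_act.
Defined.

Lemma cut_act k l (g : dhom l k) t (o : option (X k)) :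
  cut (dcomp t g) (omap (act g) (cut t o)) = cut (dcomp t g) (omap (act g) o).
Proof.
rewrite /cut; case: pselect => // e; case: pselect => // e'.
by case: e; rewrite e'; exact: act_dconst.
Qed.

Definition cyl : sSet.
Proof.
refine (@Functor (opC Delta) TypeC
  (fun k => {x : dhom k 1 * (Y k * option (X k)) | cylP x}) cyl_act _ _).
- move=> k; apply: funext => -[[t [y o]] p]; apply: eq_exist => /=.
  have d1 : dcomp t (did k) = t by exact: dhom_ext.
  rewrite act1 d1 (_ : omap _ o = o) ?(cut_id p) //.
  by case: o {p} => //= x; rewrite act1.
- move=> k l m g h; apply: funext => -[[t [y o]] p]; apply: eq_exist => /=.
  rewrite cut_act actM dcompA; congr (_, (_, cut _ _)).
  by case: o {p} => //= x; rewrite actM.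
Defined.

Lemma cyl_ext k (x y : cyl k) : sval x = sval y -> x = y.
Proof. by case: x y => [x p] [y q] /= e; exact: eq_exist. Qed.

Lemma cyl_inP k (x : X k) : cylP (dconst k ord0, (f k x, Some x)).
Proof. by right; split; [exact: dconst01|exists x]. Qed.

Lemma cyl_in_nat k l (g : dhom l k) (x : X k) :
  (exist _ _ (cyl_inP (act g x)) : cyl l) = act g (exist _ _ (cyl_inP x) : cyl k).
Proof.
apply: cyl_ext; rewrite /= act_dconst hom_act /cut; case: pselect => // e.
by case: (dconst01 e).
Qed.

Definition cyl_in : @hom sSet X cyl := mkS (X := X) (Y := cyl) cyl_in_nat.

Lemma cyl_in_inj k : injective (cyl_in k).
Proof. by move=> x y /(congr1 (fun z : cyl k => (sval z).2.2)) /= []. Qed.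

Lemma cyl_outP k (y : Y k) : cylP (dconst k ord_max, (y, None)).
Proof. by left. Qed.

Lemma cyl_out_nat k l (g : dhom l k) (y : Y k) :
  (exist _ _ (cyl_outP (act g y)) : cyl l) = act g (exist _ _ (cyl_outP y) : cyl k).
Proof.
apply: cyl_ext; rewrite /= act_dconst /cut; case: pselect => //.
Qed.

Definition cyl_out : @hom sSet Y cyl := mkS (X := Y) (Y := cyl) cyl_out_nat.

Definition cyl_proj : @hom sSet cyl Y :=
  mkS (X := cyl) (Y := Y) (h := fun k x => (sval x).2.1) (fun k l g x => erefl).

Lemma dmax_mono k (t s : dhom k 1) (v w : 'I_k.+1) : v <= w ->
  (if t v == ord0 then s v else t v) <= (if t w == ord0 then s w else t w).
Proof.
move=> vw; have := dmono t vw; have := dmono s vw; rewrite -!val_eqE /=.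
have := ltn_ord (s v); have := ltn_ord (t w).
by case: eqP; case: eqP; lia.
Qed.

Definition dmax k (t s : dhom k 1) : dhom k 1 := DHom (@dmax_mono k t s).

Lemma dmax0 k (t : dhom k 1) : dmax t (dconst k ord0) = t.
Proof. by apply: dhom_ext => v /=; case: eqP. Qed.

Lemma dmax1 k (t : dhom k 1) : dmax t (dconst k ord_max) = dconst k ord_max.
Proof.
apply: dhom_ext => v /=; case: eqP => // tv; apply: ord_inj => /=.
have /eqP := tv; rewrite -val_eqE /=; have := ltn_ord (t v); lia.
Qed.

Lemma dmax1l k (t s : dhom k 1) : t = dconst k ord_max -> dmax t s = dconst k ord_max.
Proof. by move->; exact: dhom_ext. Qed.

(** The deformation retraction of the cylinder onto Y replaces t by the maximum of t and s. *)
Definition cyl_def_fun k (x : prodS cyl (simplex 1) k) : cyl k.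
Proof.
exists (dmax (sval x.1).1 x.2, ((sval x.1).2.1, cut (dmax (sval x.1).1 x.2) (sval x.1).2.2)).
case: x => -[[t [y o]] p] s /=; apply: cylP_cut p.
exact: dmax1l.
Defined.

Lemma cyl_def_nat k l (g : dhom l k) (x : prodS cyl (simplex 1) k) :
  cyl_def_fun (act g x) = act g (cyl_def_fun x).
Proof.
case: x => -[[t [y o]] p] s; apply: cyl_ext => /=.
have -> : dcomp (dmax t s) g = dmax (dcomp t g) (dcomp s g) by exact: dhom_ext.
congr (_, (_, _)); rewrite /cut; case: pselect => // e.
case: pselect => e'; first by case: e; rewrite dmax1l.
case: pselect => // e''; case: e.
have -> : dmax (dcomp t g) (dcomp s g) = dcomp (dmax t s) g by exact: dhom_ext.
by rewrite e''; exact: act_dconst.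
Qed.

Definition cyl_def : @hom sSet (prodS cyl (simplex 1)) cyl :=
  mkS (X := prodS cyl (simplex 1)) (Y := cyl) cyl_def_nat.

Lemma cyl_def0 k x : cyl_def k (x, dconst k ord0) = x.
Proof.
case: x => -[t [y o]] p; apply: cyl_ext => /=.
by rewrite dmax0 (cut_id p).
Qed.

Lemma cyl_def1 k x : cyl_def k (x, dconst k ord_max) = cyl_out k (cyl_proj k x).
Proof.
apply: cyl_ext => /=; rewrite dmax1 /cut; case: pselect => //.
Qed.

(** [f] is [cyl_proj] after [cyl_in], and the cylinder deforms onto Y, so maps out of the cylinder
    and maps out of Y have the same homotopy classes. *)
Lemma we_cyl_in : weak_equiv f -> weak_equiv cyl_in.
Proof.
move=> wf K kK; have [inj surj] := wf K kK; split=> [u v uv|g]; last first.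
  have [h hg] := surj g; exists (mcomp h cyl_proj).
  by have -> : mcomp (mcomp h cyl_proj) cyl_in = mcomp h f by exact: natT_ext.
have D (w : @hom sSet cyl K) : homotopy w (mcomp (mcomp w cyl_out) cyl_proj).
  exists (mcomp w cyl_def) => k x.
  by split; [exact: (congr1 (w k) (cyl_def0 x))|exact: (congr1 (w k) (cyl_def1 x))].
have Din (w : @hom sSet cyl K) : homotopy (mcomp w cyl_in) (mcomp (mcomp w cyl_out) f).
  have := homotopy_precomp cyl_in (D w).
  by have -> : mcomp (mcomp (mcomp w cyl_out) cyl_proj) cyl_in =
    mcomp (mcomp w cyl_out) f by exact: natT_ext.
have out : homotopic (mcomp u cyl_out) (mcomp v cyl_out).
  apply: inj; apply: rst_trans (rst_step _ _ _ _ (Din v)).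
  exact: rst_trans (rst_sym _ _ _ _ (rst_step _ _ _ _ (Din u))) uv.
apply: rst_trans (rst_sym _ _ _ _ (rst_step _ _ _ _ (D v))).
exact: rst_trans (rst_step _ _ _ _ (D u)) (homotopic_precomp cyl_proj out).
Qed.

(** Injectivity on homotopy classes is acyclicity tested on the interval with its two ends;
    surjectivity is acyclicity tested on a point with the empty subobject. *)
Lemma acyc_we : acyc (im_sub cyl_in) (@sall cyl) -> weak_equiv f.
Proof.
move=> ac K kK; split=> [h h' /(homotopic_homotopy kK) [T TP]|g].
- pose G : srel (prodS cyl (simplex 1)) K := fun k m y =>
    (exists2 x, m.1 = cyl_in k x & y = T k (x, m.2)) \/
    ((m.2 = dconst k ord0 /\ y = h k (cyl_proj k m.1)) \/
     (m.2 = dconst k ord_max /\ y = h' k (cyl_proj k m.1))).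
  have Gp : pmap G.
    apply: pmap_union; [|apply: pmap_union|].
    + split=> [k l u [m t] _ [x /= -> ->]|k [m t] _ _ [x /= -> ->] [x' /= /cyl_in_inj <- ->]] //.
      exists (act u x); first exact: (esym (hom_act cyl_in u x)).
      exact: (esym (hom_act T u (x, t))).
    + exact: (pmap_restr (@end_closed cyl ord0)
        (graph_pmap (mcomp (mcomp h cyl_proj) (@fstS cyl (simplex 1))))).
    + exact: (pmap_restr (@end_closed cyl ord_max)
        (graph_pmap (mcomp (mcomp h' cyl_proj) (@fstS cyl (simplex 1))))).
    + by move=> k [m t] y y' /= [-> _] [e _]; case: (dconst01 e).
    + move=> k [m t] y y' [x /= -> ->] [[-> ->]|[-> ->]].
        by rewrite (TP k x).1.
      by rewrite (TP k x).2.
  have endsc : @sclosed (simplex 1) (fun k t => t = dconst k ord0 \/ t = dconst k ord_max).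
    by move=> k l u t [->|->]; [left|right]; exact: act_dconst.
  have [|G' [p' d' e']] := ac K kK _ _ endsc _ Gp.
    move=> k [m t] [_ [[x /= ->]|[/= ->|/= ->]]].
    * by exists (T k (x, t)); left; exists x.
    * by exists (h k (cyl_proj k m)); right; left.
    * by exists (h' k (cyl_proj k m)); right; right.
  have [R RP] := total_hom p' (fun k x _ => d' k x I).
  apply: rst_step.
  have Hn k l (u : dhom l k) (x : prodS Y (simplex 1) k) :
      R l (cyl_out l (act u x).1, (act u x).2) = act u (R k (cyl_out k x.1, x.2)).
    rewrite hom_act; exact: (hom_act R u (cyl_out k x.1, x.2)).
  exists (mkS (X := prodS Y (simplex 1)) Hn) => k y /=; split.
  + apply: (p'.2 _ _ _ _ (RP _ _)); apply: e'; first by split=> //; right; left.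
    by right; left.
  + apply: (p'.2 _ _ _ _ (RP _ _)); apply: e'; first by split=> //; right; right.
    by right; right.
- pose G : srel (prodS cyl (simplex 0)) K := fun k m y =>
    exists2 x, m.1 = cyl_in k x & y = g k x.
  have Gp : pmap G.
    split=> [k l u [m t] _ [x /= -> ->]|k [m t] _ _ [x /= -> ->] [x' /= /cyl_in_inj <- ->]] //.
    exists (act u x); first exact: (esym (hom_act cyl_in u x)).
    exact: (esym (hom_act g u x)).
  have Fc : @sclosed (simplex 0) (fun _ _ => False) by [].
  have [|G' [p' d' e']] := ac K kK _ _ Fc _ Gp.
    by move=> k [m t] [_ [[x /= ->]|//]]; exists (g k x), x.
  have [R RP] := total_hom p' (fun k x _ => d' k x I).
  have Rn k l (u : dhom l k) (m : cyl k) :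
      R l (act u m, dconst l ord0) = act u (R k (m, dconst k ord0)).
    exact: (hom_act R u (m, dconst k ord0)).
  pose R0 := mkS (X := cyl) Rn.
  have R0in : mcomp R0 cyl_in = g.
    apply: natT_ext => k; apply: funext => x /=.
    by apply: (p'.2 _ _ _ _ (RP _ _)); apply: e'; [split=> //; left|]; exists x.
  exists (mcomp R0 cyl_out); apply: rst_sym; apply: rst_step.
  have D : homotopy (mcomp R0 (idm cyl)) (mcomp R0 (mcomp cyl_out cyl_proj)).
    apply: homotopy_postcomp; exists cyl_def => k x.
    by split; [exact: cyl_def0|exact: cyl_def1].
  have := homotopy_precomp cyl_in D.
  have -> : mcomp (mcomp R0 (idm cyl)) cyl_in = g by rewrite compm1.
  by have -> : mcomp (mcomp R0 (mcomp cyl_out cyl_proj)) cyl_in =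
    mcomp (mcomp R0 cyl_out) f by exact: natT_ext.
Qed.

Lemma we_cyl_acyc : weak_equiv f -> acyc (im_sub cyl_in) (@sall cyl).
Proof. by move=> wf; apply: we_acyc (we_cyl_in wf); exact: cyl_in_inj. Qed.

End MappingCylinder.

Section Diagonal.
Variables (Y Z : functor (opC Delta) sSet) (t : natT Y Z).

Lemma hact_nat p q (theta : dhom q p) k (y : Y p k) :
  t q k (hact theta y) = hact theta (t p k y).
Proof. exact: (congr1 (fun h : natT (Y p) (Z q) => h k y) (@natural _ _ _ _ t p q theta)). Qed.

Definition cylB_fun p q (theta : dhom q p) k (x : cyl (t p) k) : cyl (t q) k.
Proof.
exists ((sval x).1, (hact theta (sval x).2.1, omap (fun y => hact theta y) (sval x).2.2)).
case: x => -[s [z o]] /= [[/= -> ->]|[/= ns [x -> ->]]]; first by left.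
by right; split=> //; exists (hact theta x); rewrite //= hact_nat.
Defined.

Lemma cylB_nat p q (theta : dhom q p) k l (g : dhom l k) (x : cyl (t p) k) :
  cylB_fun theta (act g x) = act g (cylB_fun theta x).
Proof.
apply: cyl_ext; rewrite /= hact_act; congr (_, (_, _)).
rewrite /cut; case: pselect => //= _; case: (sval x).2.2 => //= y.
by rewrite hact_act.
Qed.

Definition cylB : functor (opC Delta) sSet.
Proof.
refine (@Functor (opC Delta) sSet (fun p => cyl (t p))
  (fun p q theta => @mkS (cyl (t p)) (cyl (t q)) _ (@cylB_nat p q theta)) _ _).
- move=> p; apply: natT_ext => k; apply: funext => -[[s [z o]] P].
  apply: cyl_ext; rewrite /= hact1; congr (_, (_, _)).
  by case: o {P} => //= y; rewrite hact1.
- move=> p q r g f; apply: natT_ext => k; apply: funext => -[[s [z o]] P].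
  apply: cyl_ext; rewrite /= hactM; congr (_, (_, _)).
  by case: o {P} => //= y; rewrite hactM.
Defined.

Lemma diag_cyl_nat k l (g : dhom l k) (x : diag cylB k) :
  (act g x : cyl (diag_hom t) l) = act g (x : cyl (diag_hom t) k).
Proof.
apply: cyl_ext; rewrite /= /cut; case: pselect => //= _.
by case: (sval x).2.2.
Qed.

Definition diag_cyl : @hom sSet (diag cylB) (cyl (diag_hom t)) :=
  mkS (X := diag cylB) (Y := cyl (diag_hom t)) diag_cyl_nat.

(** The cylinder is described simplex by simplex, so it commutes with diagonals: [cylB] has the
    cylinder of [diag_hom t] as its diagonal. *)
Lemma diag_we : (forall p, weak_equiv (t p)) -> weak_equiv (diag_hom t).
Proof.
move=> wt; apply: acyc_we.
have := @acyc_img _ _ diag_cyl _ _ _ (@diag_acyc cylB (fun p => im_sub (cyl_in (t p))) _ _ _).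
move=> H; apply: acyc_iff (H _ _ _ _) => //.
- move=> k x; split=> [[_ -> [y ->]]|[y ->]]; [exists y; exact: cyl_ext|].
  by exists (cyl_in (t k) k y); [exact: cyl_ext|exists y].
- by move=> k x; split=> // _; exists x.
- by move=> k x x'.
- move=> p q theta k _ [y ->]; exists (hact theta y); apply: cyl_ext.
  by rewrite /= hact_nat.
- by move=> p; exact: im_closed.
- by move=> p; exact: we_cyl_acyc.
Qed.

End Diagonal.

Lemma we_comp X Y Z (g : @hom sSet Y Z) (f : @hom sSet X Y) :
  weak_equiv f -> weak_equiv g -> weak_equiv (mcomp g f).
Proof.
move=> wf wg K kK; have [fi fs] := wf K kK; have [gi gs] := wg K kK.
split=> [h h'|a]; first by rewrite !compA => /fi/gi.
have [b ba] := fs a; have [c cb] := gs b; exists c.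
by rewrite compA; apply: rst_trans ba; exact: homotopic_precomp.
Qed.

Lemma we_cancel X Y Z (g : @hom sSet Y Z) (f : @hom sSet X Y) :
  weak_equiv g -> weak_equiv (mcomp g f) -> weak_equiv f.
Proof.
move=> wg wgf K kK; have [gi gs] := wg K kK; have [gfi gfs] := wgf K kK.
split=> [h h' hh|a].
- have [c ch] := gs h; have [c' ch'] := gs h'.
  apply: rst_trans (rst_sym _ _ _ _ ch) (rst_trans _ _ _ _ _ _ ch').
  apply: homotopic_precomp; apply: gfi; rewrite !compA.
  apply: rst_trans (homotopic_precomp f ch) _.
  exact: rst_trans hh (rst_sym _ _ _ _ (homotopic_precomp f ch')).
- by have [c ca] := gfs a; exists (mcomp c g); rewrite -compA.
Qed.

Lemma we_iso X Y (e : @hom sSet X Y) (e' : @hom sSet Y X) :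
  (forall k x, e' k (e k x) = x) -> (forall k y, e k (e' k y) = y) -> weak_equiv e.
Proof.
move=> e1 e2 K kK.
have E1 : mcomp e' e = idm X by apply: natT_ext => k; apply: funext => x; exact: e1.
have E2 : mcomp e e' = idm Y by apply: natT_ext => k; apply: funext => x; exact: e2.
split=> [h h' /(homotopic_precomp e')|g]; first by rewrite -!compA E2 !compm1.
by exists (mcomp g e'); rewrite -compA E1 compm1; exact: rst_refl.
Qed.

Definition prod_hom (X Y Z : sSet) (f : @hom sSet X Y) :
  @hom sSet (prodS X Z) (prodS Y Z) := pairS (mcomp f (@fstS X Z)) (@sndS X Z).

Section ProductWeakEquiv.
Variables (X Y Z : sSet) (f : @hom sSet X Y).

Definition cylX_fun k (x : prodS (cyl f) Z k) : cyl (prod_hom Z f) k.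
Proof.
exists ((sval x.1).1, (((sval x.1).2.1, x.2), omap (fun y => (y, x.2)) (sval x.1).2.2)).
case: x => -[[s [y o]] /= [[/= -> ->]|[/= ns [x -> ->]]]] z /=; first by left.
by right; split=> //; exists (x, z).
Defined.

Lemma cylX_nat k l (g : dhom l k) (x : prodS (cyl f) Z k) :
  cylX_fun (act g x) = act g (cylX_fun x).
Proof.
apply: cyl_ext; congr (_, (_, _)) => /=; rewrite /cut; case: pselect => //= _.
by case: (sval x.1).2.2.
Qed.

(** The product of the cylinder of f with Z is the cylinder of f x Z, and acyclicity passes to
    products by [acyc_box] with C empty. *)
Lemma prod_we : weak_equiv f -> weak_equiv (prod_hom Z f).
Proof.
move=> /we_cyl_acyc /(@acyc_box _ _ Z (fun _ _ => False)) ac; apply: acyc_we.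
pose u := mkS (X := prodS (cyl f) Z) (Y := cyl (prod_hom Z f)) cylX_nat.
have ui k : injective (u k).
  move=> [[[s [y o]] P] z] [[[s' [y' o']] P'] z'] /(congr1 sval) /= [es ey ez eo].
  congr (_, _); last exact: ez.
  apply: cyl_ext => /=; rewrite es ey; congr (_, (_, _)).
  by case: o o' eo {P P'} => [a|] [a'|] //= [->].
apply: acyc_iff (acyc_img ui (ac _)) => // k x.
- split=> [[[m z] -> [[y /= ->]|//]]|[[y z] ->]].
    by exists (y, z); exact: cyl_ext.
  by exists (cyl_in f k y, z); [exact: cyl_ext|left; exists y].
- split=> // _; case: x => -[s [[y z] o]] P.
  have P0 : cylP f (s, (y, omap fst o)).
    case: P => [[/= -> ->]|[/= ns [[x z'] -> [-> _]]]]; first by left.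
    by right; split=> //; exists x.
  exists (exist _ _ P0 : cyl f k, z) => //; apply: cyl_ext => /=.
  congr (_, (_, _)); case: P {P0} => [[/= _ ->]|[/= ns [[x z'] -> [_ <-]]]] //.
Qed.

End ProductWeakEquiv.

Definition pow_hom (I : Type) (X Y : sSet) (f : @hom sSet X Y) :
  @hom sSet (powS I X) (powS I Y) :=
  mkS (X := powS I X) (Y := powS I Y) (h := fun k x i => f k (x i))
    (fun k l g x => funext (fun i => hom_act f g (x i))).

Section PowerSplit.
Variables (n : nat) (X : sSet).

Definition pow_split : @hom sSet (powS 'I_n.+1 X) (prodS X (powS 'I_n X)) :=
  mkS (X := powS 'I_n.+1 X) (Y := prodS X (powS 'I_n X))
    (h := fun k x => (x ord0, fun i => x (lift ord0 i))) (fun k l g x => erefl).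

Definition pow_join_fun k (x : prodS X (powS 'I_n X) k) : powS 'I_n.+1 X k :=
  fun i => if unlift ord0 i is Some j then x.2 j else x.1.

Lemma pow_join_nat k l (g : dhom l k) (x : prodS X (powS 'I_n X) k) :
  pow_join_fun (act g x) = act g (pow_join_fun x).
Proof.
apply: funext => i; rewrite /pow_join_fun [RHS]/(act g _).
by case: unliftP.
Qed.

Lemma pow_split_we : weak_equiv pow_split.
Proof.
apply: (we_iso (e' := mkS (X := prodS X (powS 'I_n X)) (Y := powS 'I_n.+1 X) pow_join_nat)).
- move=> k x; apply: funext => i /=; rewrite /pow_join_fun /=.
  by case: unliftP => [j|] ->.
- move=> k [x y]; congr pair; rewrite /= /pow_join_fun; first by rewrite unlift_none.
  by apply: funext => i; rewrite liftK.
Qed.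

End PowerSplit.

Lemma swap_we X Y : weak_equiv (swapS X Y).
Proof. by apply: (we_iso (e' := swapS Y X)) => k []. Qed.

Lemma pow_we n X Y (f : @hom sSet X Y) : weak_equiv f -> weak_equiv (pow_hom 'I_n f).
Proof.
move=> wf; elim: n => [|n IH].
  pose e' : @hom sSet (powS 'I_0 Y) (powS 'I_0 X) :=
    mkS (X := powS 'I_0 Y) (Y := powS 'I_0 X)
     (h := fun k y (i : 'I_0) => False_rect (X k) (notF (ltn_ord i)))
     (fun k l g y => funext (fun i : 'I_0 => False_ind _ (notF (ltn_ord i)))).
  by apply: (we_iso (e' := e')) => k x; apply: funext => -[].
apply: we_cancel (pow_split_we n Y) _.
(* One factor is changed at a time; [prod_hom] acts on the first factor only, whence the swaps. *)
have -> : mcomp (pow_split n Y) (pow_hom 'I_n.+1 f) =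
    mcomp (mcomp (swapS _ _) (mcomp (prod_hom Y (pow_hom 'I_n f)) (swapS _ _)))
          (mcomp (prod_hom _ f) (pow_split n X)).
  exact: natT_ext.
apply: we_comp; apply: we_comp.
- exact: pow_split_we.
- exact: prod_we.
- by apply: we_comp; [exact: swap_we|exact: prod_we].
- exact: swap_we.
Qed.

Section DiagonalProducts.
Variable Z : functor (opC Delta) sSet.

Lemma prodB_nat (Y Y' : functor (opC Delta) sSet) p q (theta : dhom q p)
  k l (f : dhom l k) (x : prodS (Y p) (Y' p) k) :
  (hact theta (act f x).1, hact theta (act f x).2) =
  act f ((hact theta x.1, hact theta x.2) : prodS (Y q) (Y' q) k).
Proof. by congr pair; exact: hact_act. Qed.

Definition prodB (Y Y' : functor (opC Delta) sSet) : functor (opC Delta) sSet.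
Proof.
refine (@Functor (opC Delta) sSet (fun p => prodS (Y p) (Y' p))
  (fun p q theta => @mkS (prodS (Y p) (Y' p)) (prodS (Y q) (Y' q)) _
     (prodB_nat theta)) _ _).
- by move=> p; apply: natT_ext => k; apply: funext => -[x y] /=; rewrite !hact1.
- by move=> p q r g f; apply: natT_ext => k; apply: funext => -[x y] /=; rewrite !hactM.
Defined.

Lemma diag_pair_we (Y Y' : functor (opC Delta) sSet) (f : natT Z Y) (g : natT Z Y') :
  (forall p, weak_equiv (pairS (f p) (g p))) ->
  weak_equiv (pairS (diag_hom f) (diag_hom g) : @hom sSet _ _).
Proof.
move=> w.
have tn p q (theta : @hom (opC Delta) p q) :
    mcomp (pairS (f q) (g q) : @hom sSet (Z q) (prodB Y Y' q)) (fmap Z theta) =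
    mcomp (fmap (prodB Y Y') theta) (pairS (f p) (g p) : @hom sSet (Z p) (prodB Y Y' p)).
  by apply: natT_ext => k; apply: funext => z; congr pair; exact: (hact_nat _ theta z).
have := diag_we (t := @NatT _ _ Z (prodB Y Y') (fun p => pairS (f p) (g p)) tn) w.
(* Diagonals preserve products on the nose; [e] is the identity on simplices. *)
pose e : @hom sSet (diag (prodB Y Y')) (prodS (diag Y) (diag Y')) :=
  mkS (X := diag (prodB Y Y')) (Y := prodS (diag Y) (diag Y')) (h := fun k x => x)
    (fun k l g x => erefl).
pose e' : @hom sSet (prodS (diag Y) (diag Y')) (diag (prodB Y Y')) :=
  mkS (X := prodS (diag Y) (diag Y')) (Y := diag (prodB Y Y')) (h := fun k x => x)
    (fun k l g x => erefl).
have we : weak_equiv e by exact: (we_iso (e' := e')).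
move=> wd; have := we_comp wd we.
by congr weak_equiv; exact: natT_ext.
Qed.

Lemma powB_nat (I : Type) (Y : functor (opC Delta) sSet) p q (theta : dhom q p)
  k l (f : dhom l k) (x : powS I (Y p) k) :
  (fun i => hact theta (act f x i)) =
  act f ((fun i => hact theta (x i)) : powS I (Y q) k).
Proof. by apply: funext => i; exact: hact_act. Qed.

Definition powB (I : Type) (Y : functor (opC Delta) sSet) : functor (opC Delta) sSet.
Proof.
refine (@Functor (opC Delta) sSet (fun p => powS I (Y p))
  (fun p q theta => @mkS (powS I (Y p)) (powS I (Y q)) _ (powB_nat theta)) _ _).
- by move=> p; apply: natT_ext => k; apply: funext => x; apply: funext => i /=; rewrite hact1.
- move=> p q r g f; apply: natT_ext => k; apply: funext => x; apply: funext => i /=.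
  by rewrite hactM.
Defined.

Lemma diag_tup_we (I : Type) (Y : functor (opC Delta) sSet) (f : I -> natT Z Y) :
  (forall p, weak_equiv (tupS (fun i => f i p))) ->
  weak_equiv (tupS (fun i => diag_hom (f i)) : @hom sSet _ _).
Proof.
move=> w.
have tn p q (theta : @hom (opC Delta) p q) :
    mcomp (tupS (fun i => f i q) : @hom sSet (Z q) (powB I Y q)) (fmap Z theta) =
    mcomp (fmap (powB I Y) theta) (tupS (fun i => f i p) : @hom sSet (Z p) (powB I Y p)).
  apply: natT_ext => k; apply: funext => z; apply: funext => i.
  exact: (hact_nat (f i) theta z).
have := diag_we (t := @NatT _ _ Z (powB I Y) (fun p => tupS (fun i => f i p)) tn) w.
pose e : @hom sSet (diag (powB I Y)) (powS I (diag Y)) :=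
  mkS (X := diag (powB I Y)) (Y := powS I (diag Y)) (h := fun k x => x)
    (fun k l g x => erefl).
pose e' : @hom sSet (powS I (diag Y)) (diag (powB I Y)) :=
  mkS (X := powS I (diag Y)) (Y := diag (powB I Y)) (h := fun k x => x)
    (fun k l g x => erefl).
have we : weak_equiv e by exact: (we_iso (e' := e')).
move=> wd; have := we_comp wd we.
by congr weak_equiv; exact: natT_ext.
Qed.

End DiagonalProducts.

(** * The classifying space *)

Lemma segal_id p (s : 'I_p) : segal_fun (did p) s = [set s].
Proof. exact: (congr1 (fun u : ghom p p => u s) (fmap1 segal p)). Qed.

Section ClassifyingSpace.
Variables (X : functor (opC DG) sSet) (HX : DG_space X).

Let mu1 p a b (u : @hom DG a b) : @hom DG (a.1, p * a.2) (b.1, p * b.2) :=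
  mu_hom (segal_hom (did p)) u.

Lemma BX_point : is_point (BX X (0, 0)).
Proof.
have P z : z = 0 -> is_point (X (0, z)) by move=> ->; exact: DG_point HX.
by move=> k; exact: (P (k * 0) (muln0 k) k).
Qed.

(** In degree p the object C_{m,0} becomes C_{m,p*0}, and p * 0 is not convertible to 0; [z] makes
    the equation available for substitution. A morphism out of C_{m,0} is determined by its functor
    part. *)
Lemma l1xl2_we m q z (a : @hom DG (m, z) (m, q)) (b : @hom DG (0, q) (m, q)) :
  z = 0 -> (forall i, Lf a i = i) -> b = l2 m q ->
  weak_equiv (pairS (@fmap _ _ X (m, q) (m, z) a) (@fmap _ _ X (m, q) (0, q) b)).
Proof.
move=> z0; subst z => ai ->; have -> : a = l1 m q by apply: DG_ext => // i [].
exact: DG_prod.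
Qed.

Lemma BX_prod m n : weak_equiv (l1xl2 (BX X) m n).
Proof.
apply: (@diag_pair_we (bX X (m, n)) (bX X (m, 0)) (bX X (0, n))
  (fmap (bX X) (l1 m n)) (fmap (bX X) (l2 m n))) => p.
apply: (@l1xl2_we m (p * n) (p * 0) (mu1 p (l1 m n)) (mu1 p (l2 m n))) => //.
  exact: muln0.
apply: DG_ext => //= i k; apply/setP => l; rewrite [LHS]in_set /= segal_id !inE.
rewrite -(inj_eq (@unpair_inj p n)).
by rewrite [unpair l]surjective_pairing [unpair k]surjective_pairing.
Qed.

Lemma BSegal_we n z (a : 'I_n -> @hom DG (1, z) (n, z)) :
  z = 0 -> (forall k i, Lf (a k) i = dgamma k i) ->
  weak_equiv (tupS (fun k => @fmap _ _ X (n, z) (1, z) (a k))).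
Proof.
move=> z0; subst z => ai; have -> : a = fun k => fmap CD (dgamma k : @hom Delta 1 n).
  by apply: funext => k; apply: DG_ext => // i [].
exact: DG_BSegal HX n.
Qed.

Lemma BX_BSegal n : weak_equiv (BSegal_map (BX X) n).
Proof.
apply: (@diag_tup_we (bX X (n, 0)) 'I_n (bX X (1, 0))
  (fun k => fmap (bX X) (fmap CD (dgamma k : @hom Delta 1 n)))) => p.
apply: (@BSegal_we n (p * 0)
  (fun k => mu1 p (fmap CD (dgamma k : @hom Delta 1 n)))) => //.
exact: muln0.
Qed.

Section Reindex.
Variables (p n : nat) (Z : sSet).

(** The exponent is p * 1 and not p because B X at C_{0,1} is, in degree p, X(C_{0,p*1}). *)
Definition reindex : @hom sSet (powS 'I_(p * n) Z) (powS 'I_n (powS 'I_(p * 1) Z)) :=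
  mkS (X := powS 'I_(p * n) Z) (Y := powS 'I_n (powS 'I_(p * 1) Z))
    (h := fun k x i j => x (mxvec_index (unpair j).1 i)) (fun k l g x => erefl).

Lemma reindex_we : weak_equiv reindex.
Proof.
pose e' : @hom sSet (powS 'I_n (powS 'I_(p * 1) Z)) (powS 'I_(p * n) Z) :=
  mkS (X := powS 'I_n (powS 'I_(p * 1) Z)) (Y := powS 'I_(p * n) Z)
    (h := fun k x l => x (unpair l).2 (mxvec_index (unpair l).1 ord0))
    (fun k l g x => erefl).
apply: (we_iso (e' := e')) => k x /=.
  by apply: funext => l; rewrite mxvec_indexK unpairK.
apply: funext => i; apply: funext => j; rewrite mxvec_indexK /=.
by congr (x i _); rewrite -[RHS]unpairK [(unpair j).2]ord1.
Qed.

End Reindex.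

Lemma BX_Segal n : weak_equiv (Segal_map (BX X) n).
Proof.
apply: (@diag_tup_we (bX X (0, n)) 'I_n (bX X (0, 1))
  (fun k => fmap (bX X) (fmap CG (gphi k : @hom Gamma 1 n)))) => p.
set f := tupS _.
apply: (we_cancel (pow_we n (DG_Segal HX (p * 1)))).
suff -> : mcomp (pow_hom 'I_n (Segal_map X (p * 1))) f =
    mcomp (@reindex p n (XG X 1)) (Segal_map X (p * n)).
  by apply: we_comp; [exact: DG_Segal|exact: reindex_we].
apply: natT_ext => k; apply: funext => x; apply: funext => i; apply: funext => j.
pose a : @hom DG (0, p * 1) (0, p * n) := mu1 p (fmap CG (gphi i : @hom Gamma 1 n)).
(* In Gamma, picking j in the p-element set and then placing it in the i-th of n copies picks the
   index (j, i) of the product. *)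
have E : mcomp a (fmap CG (gphi j : @hom Gamma 1 (p * 1))) =
    fmap CG (gphi (mxvec_index (unpair j).1 i) : @hom Gamma 1 (p * n)).
  apply: DG_ext => //= v y; apply/setP => l; rewrite big_set1 in_set /= segal_id !inE.
  rewrite -(inj_eq (@unpair_inj p n)) mxvec_indexK.
  by rewrite [unpair l]surjective_pairing.
have := congr1 (fun u : @hom DG (0, 1) (0, p * n) =>
  (@fmap _ _ X (0, p * n) (0, 1) u : natT _ _) k x) E.
by move=> /= <-; rewrite -[LHS]/((mcomp (fmap X _) (fmap X a) : natT _ _) k x) -fmapM.
Qed.

End ClassifyingSpace.

Theorem theorem4p6 (X : functor (opC DG) sSet) : DG_space X -> DG_space (BX X).
Proof.
move=> HX; split.
- exact: BX_point.
- exact: BX_Segal.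
- exact: BX_BSegal.
- exact: BX_prod.
Qed.
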